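(* There is a subshift $(X,\sigma)$ such that (a) $(X,\sigma)$ is strictly ergodic; (b) $(X,\sigma)$ has positive topological entropy; (c) the local correlation entropy $h_{\mathrm{cor}}(\sigma,y)$ at every $y\in X$ (exists and) is zero; (d) the correlation entropy $h_{\mathrm{cor}}(\sigma,\mu)$ of the unique invariant measure $\mu$ (exists and) is zero.
   Context: $\mathbb{N}=\{1,2,\dots\}$, $\mathbb{N}_0=\mathbb{N}\cup\{0\}$. For an integer $p\ge2$ let $\mathcal{A}_p=\{0,\dots,p-1\}$ and $\Sigma_p=\mathcal{A}_p^{\mathbb{N}_0}$ with the metric $\varrho(x,y)=2^{-k}$, $k=\min\{i\ge0:x_i\ne y_i\}$, for $x\neq y$, and $\varrho(x,x)=0$. The shift $\sigma:\Sigma_p\to\Sigma_p$ is $\sigma((x_i)_i)=(x_{i+1})_i$. A subshift $(X,\sigma)$ is the restriction of $\sigma$ to a nonempty closed set $X\subseteq\Sigma_p$ with $\sigma(X)\subseteq X$ (for some $p\ge 2$). A system $(X,f)$ ($X$ compact metric, $f:X\to X$ continuous) is strictly ergodic if it is minimal (no nonempty proper closed subset $A$ of $X$ with $f(A)\subseteq A$) and has exactly one $f$-invariant Borel probability measure. For $m\in\mathbb{N}$ let $\varrho^f_m(y,z)=\max_{0\le i<m}\varrho(f^i(y),f^i(z))$. For $x\in X$, $m,n\in\mathbb{N}$, $\varepsilon>0$ let $$C^f_m(x,n,\varepsilon)=\frac1{n^2}\,\mathrm{card}\{(i,j):0\le i,j<n,\ \varrho^f_m(f^i(x),f^j(x))\le\varepsilon\},$$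 $\overline{c}^f_m(x,\varepsilon)=\limsup_{n\to\infty}C^f_m(x,n,\varepsilon)$, $\underline{c}^f_m(x,\varepsilon)=\liminf_{n\to\infty}C^f_m(x,n,\varepsilon)$. The upper and lower local correlation entropies at $x$ are $$\overline{h}_{\mathrm{cor}}(f,x)=\lim_{\varepsilon\to0}\limsup_{m\to\infty}\left(-\frac1m\right)\log\underline{c}^f_m(x,\varepsilon),\qquad \underline{h}_{\mathrm{cor}}(f,x)=\lim_{\varepsilon\to0}\liminf_{m\to\infty}\left(-\frac1m\right)\log\overline{c}^f_m(x,\varepsilon).$$ If they are equal, the local correlation entropy $h_{\mathrm{cor}}(f,x)$ exists and is their common value. For an $f$-invariant Borel probability measure $\mu$ put $c^f_m(\mu,\varepsilon)=\mu\times\mu\{(y,z)\in X\times X:\varrho^f_m(y,z)\le\varepsilon\}$ and $$\overline{h}_{\mathrm{cor}}(f,\mu)=\lim_{\varepsilon\to0}\limsup_{m\to\infty}\left(-\frac1m\right)\log c^f_m(\mu,\varepsilon),\qquad \underline{h}_{\mathrm{cor}}(f,\mu)=\lim_{\varepsilon\to0}\liminf_{m\to\infty}\left(-\frac1m\right)\log c^f_m(\mu,\varepsilon);$$ if these are equal, their common value is the correlation entropy $h_{\mathrm{cor}}(f,\mu)$. *)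

(* Defs.v *)
From HB Require Import structures.
From mathcomp Require Import all_boot all_order all_algebra finmap.
From mathcomp Require Import all_classical all_reals all_analysis.

Set Implicit Arguments.
Unset Strict Implicit.
Unset Printing Implicit Defensive.

Import Order.TTheory GRing.Theory Num.Theory.
Import numFieldNormedType.Exports.

Local Open Scope classical_set_scope.
Local Open Scope ring_scope.

(* The library's measurable types are pointed, so Borel measures on a metric
   space need a metric space with a distinguished point. *)
#[short(type="pmetricType")]
HB.structure Definition PointedMetric (K : numDomainType) :=
  { M of Pointed M & Metric K M }.

(** A system is a map [f : T -> T] restricted to a subset [X] of a metric space
    [T], to be used for [X] closed, nonempty and [f @` X `<=` X]. *)

Section Entropies.
Context {R : realType} {T : metricType R}.
Implicit Types (f : T -> T) (X : set T) (x y z : T) (m n : nat) (eps : R).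

Definition bowen_dist f m y z : R :=
  \big[Num.max/0]_(i < m) mdist (iter i f y) (iter i f z).

Definition correlation_sum f m x n eps : R :=
  #|[pred ij : 'I_n * 'I_n |
      bowen_dist f m (iter ij.1 f x) (iter ij.2 f x) <= eps]|%:R / n%:R ^+ 2.

Definition upper_correlation f m x eps : \bar R :=
  limn_esup (fun n => (correlation_sum f m x n eps)%:E).

Definition lower_correlation f m x eps : \bar R :=
  limn_einf (fun n => (correlation_sum f m x n eps)%:E).

(* [- (1/m) log c]; it is [+oo] when [c = 0] and [0 < m]. The values at [m = 0]
   do not matter, since only limits superior and inferior in [m] are taken. *)
Definition decay_rate m (c : \bar R) : \bar R := (- (m%:R^-1)%:E * lne c)%E.

Definition upper_local_correlation_entropy_is f x (h : \bar R) : Prop :=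
  limn_esup (fun m => decay_rate m (lower_correlation f m x eps))
    @[eps --> 0^'+] --> h.

Definition lower_local_correlation_entropy_is f x (h : \bar R) : Prop :=
  limn_einf (fun m => decay_rate m (upper_correlation f m x eps))
    @[eps --> 0^'+] --> h.

Definition local_correlation_entropy_is f x (h : \bar R) : Prop :=
  upper_local_correlation_entropy_is f x h /\
  lower_local_correlation_entropy_is f x h.

Definition bowen_separated f m eps (E : {fset T}) : Prop :=
  forall y z, y \in E -> z \in E -> y != z -> eps < bowen_dist f m y z.

Definition separation_number X f m eps : \bar R :=
  ereal_sup [set (#|` E|%:R)%:E | E in
    [set E : {fset T} | [set` E] `<=` X /\ bowen_separated f m eps E]].

(* Bowen's definition of topological entropy. *)
Definition topological_entropy_is X f (h : \bar R) : Prop :=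
  limn_esup (fun m => (m%:R^-1)%:E * lne (separation_number X f m eps))%E
    @[eps --> 0^'+] --> h.

Definition minimal_system X f : Prop :=
  forall A, A `<=` X -> closed A -> A !=set0 -> f @` A `<=` A -> A = X.

End Entropies.

Definition borel (T : ptopologicalType) := g_sigma_algebraType (@open T).

Section InvariantMeasures.
Context {R : realType} {T : pmetricType R}.
Implicit Types (X : set T) (f : T -> T) (mu nu : probability (borel T) R).

(* Borel probability measures on the closed set [X] are identified with the
   Borel probability measures on [T] giving [X] full measure. *)
Definition invariant_probability X f mu : Prop :=
  mu X = 1%E /\
  forall A : set (borel T), measurable A -> mu (f @^-1` A) = mu A.

(* Measures are functions on all subsets, with unspecified values on
   nonmeasurable ones; uniqueness is therefore agreement on Borel sets. *)
Definition uniquely_ergodic X f : Prop :=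
  exists2 mu, invariant_probability X f mu &
  forall nu, invariant_probability X f nu ->
    forall A : set (borel T), measurable A -> nu A = mu A.

Definition strictly_ergodic X f : Prop := minimal_system X f /\ uniquely_ergodic X f.

Definition measure_correlation X f mu (m : nat) (eps : R) : \bar R :=
  (mu \x mu)%E [set yz | [/\ X yz.1, X yz.2 & bowen_dist f m yz.1 yz.2 <= eps]].

Definition upper_correlation_entropy_is X f mu (h : \bar R) : Prop :=
  limn_esup (fun m => decay_rate m (measure_correlation X f mu m eps))
    @[eps --> 0^'+] --> h.

Definition lower_correlation_entropy_is X f mu (h : \bar R) : Prop :=
  limn_einf (fun m => decay_rate m (measure_correlation X f mu m eps))
    @[eps --> 0^'+] --> h.

Definition correlation_entropy_is X f mu (h : \bar R) : Prop :=
  upper_correlation_entropy_is X f mu h /\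
  lower_correlation_entropy_is X f mu h.

End InvariantMeasures.

(* One-sided sequences over an alphabet of [p = q.+2] symbols, so that [p >= 2].
   The parameter [R] only fixes the field in which the metric takes values. *)
Definition Sigma (R : realType) (q : nat) : Type := nat -> 'I_q.+2.

Section FullShift.
Context {R : realType} {q : nat}.
Implicit Types x y z : Sigma R q.

Definition rho x y : R :=
  match pselect (exists i, x i != y i) with
  | left xy => 2 ^- ex_minn xy
  | right _ => 0
  end.

Lemma rhoxx x : rho x x = 0.
Proof.
by rewrite /rho; case: pselect => // -[i xxi]; exfalso; move: xxi; rewrite eqxx.
Qed.

Lemma rho_ge0 x y : 0 <= rho x y.
Proof.
by rewrite /rho; case: pselect => // xy; rewrite invr_ge0 exprn_ge0.
Qed.

Lemma rho_positivity x y : rho x y = 0 -> x = y.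
Proof.
rewrite /rho; case: pselect => [xy /eqP|xy _].
  by rewrite invr_eq0 expf_eq0 pnatr_eq0 andbF.
apply/funext => i; apply/eqP; apply: contra_notT xy => xyi.
by exists i.
Qed.

Lemma rho_sym x y : rho x y = rho y x.
Proof.
rewrite /rho; case: pselect => [xy|xy]; case: pselect => [yx|yx] //.
- by congr (2 ^- _); apply: eq_ex_minn => i; rewrite eq_sym.
- by case: yx; case: xy => i xyi; exists i; rewrite eq_sym.
- by case: xy; case: yx => i yxi; exists i; rewrite eq_sym.
Qed.

Lemma rho_le x y i : x i != y i -> 2 ^- i <= rho x y.
Proof.
move=> xyi; rewrite /rho; case: pselect => [xy|[]]; last by exists i.
case: ex_minnP => k _ /(_ i xyi) ki.
by rewrite lef_pV2 ?posrE ?exprn_gt0// ler_eXn2l// ltr1n.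
Qed.

Lemma rho_triangle y x z : rho x z <= rho x y + rho y z.
Proof.
rewrite [leLHS]/rho; case: pselect => [xz|_]; last by rewrite addr_ge0 ?rho_ge0.
case: ex_minnP => k xzk _.
have [xyk|xyk] := eqVneq (x k) (y k).
  by rewrite ler_wpDl ?rho_ge0 ?rho_le// -xyk.
by rewrite ler_wpDr ?rho_ge0 ?rho_le.
Qed.

End FullShift.

HB.instance Definition _ (R : realType) (q : nat) :=
  Choice.copy (Sigma R q) (nat -> 'I_q.+2).

HB.instance Definition _ (R : realType) (q : nat) :=
  isPointed.Build (Sigma R q) (fun=> ord0).

HB.instance Definition _ (R : realType) (q : nat) :=
  @isMetric.Build R (Sigma R q) rho rhoxx rho_positivity rho_sym rho_triangle.

Definition shift_map {R : realType} {q : nat} (x : Sigma R q) : Sigma R q :=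
  fun i => x i.+1.

Definition subshift {R : realType} {q : nat} (X : set (Sigma R q)) : Prop :=
  [/\ X !=set0, closed X & shift_map @` X `<=` X].

(* Main.v *)
(** Each stage of the construction is a finite set of binary words ([blocks k])
    of a common length n_k.  A word of stage k+1 consists of r_k copies of one
    distinguished word u_k of stage k, followed by all the N_k words of stage k
    in some order, and every order is used.  With r_k about N_k / n_k:
    - all words of stage k+1 have the same content in words of stage k, so that
      the frequency of any given word is uniform up to O(1/n_k): strict
      ergodicity;
    - N_(k+1) = N_k!, and the repetitions lengthen words by a factor of only
      1 + 1/n_k at most: log N_k / n_k stays bounded below, hence positive
      entropy;
    - the prefixes of u_k u_k u_k ... are very frequent: for each m some word of
      length m has frequency at least (5 (m+1))^-4 in every point, so that
      correlation sums decay only polynomially in m. *)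

Require Import Defs.
From mathcomp Require Import all_boot all_order all_algebra finmap zify ring lra.
From mathcomp Require Import all_classical all_reals all_analysis measurable_realfun.

Set Implicit Arguments.
Unset Strict Implicit.
Unset Printing Implicit Defensive.

Import Order.TTheory GRing.Theory Num.Theory.
Import numFieldNormedType.Exports.

(** * Occurrences of a word *)

(** Positive entropy makes typical words of length m exponentially rare, but a correlation sum is at
    least the square of the frequency of any single word, so one exceptional word for each length is
    enough to force zero correlation entropy. The run of r_k copies of u_k is periodic and its
    length, about N_k, is exponential in n_k, while it fills a share of only about 1/n_k of a word
    of stage k+1. A prefix of the run of length m, at most about half of it, starts at half of the
    copies or more, hence at a share of order n_k^-2 of all positions. If m exceeds half the run of
    stage k-1, then N_(k-1) = O(m), so n_k, of order N_(k-1) n_(k-1), is O(m^2). Thus the runs of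
    successive stages leave no gap between the lengths that they serve, and the exponent 4 is 2
    times 2. *)

Section Occurrences.
Context {T : eqType}.
Implicit Types (w v z a b : seq T) (L B : seq (seq T)) (x : nat -> T).

(** Overlapping occurrences all count, and the empty word counts once per letter but not at the end,
    so that [occ_size] holds for every [w]. *)
Fixpoint occ w v : nat :=
  if v is _ :: v' then prefix w v + occ w v' else 0.

Lemma occ_cons w c v : occ w (c :: v) = prefix w (c :: v) + occ w v.
Proof. by []. Qed.

Lemma occ_size w v : occ w v <= size v.
Proof. by elim: v => // c v IH; rewrite occ_cons [size _]/= -add1n leq_add ?leq_b1. Qed.

Lemma prefix_cat_size w a b : size w <= size a -> prefix w (a ++ b) = prefix w a.
Proof.
by move=> wa; rewrite !prefixE takel_cat.
Qed.

Lemma leq_occ_cat w a b : occ w a + occ w b <= occ w (a ++ b).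
Proof.
elim: a => // c a IH; rewrite cat_cons !occ_cons -addnA leq_add//.
by case: (boolP (prefix w (c :: a))) => // wa;
  rewrite -cat_cons prefix_catl.
Qed.

Lemma occ_cat_leq w a b : occ w (a ++ b) <= occ w a + occ w b + size w.
Proof.
(* Only occurrences across the junction are new, and they start among the last [size w] letters of
   [a]; the [minn] is what the induction on [a] can carry. *)
suff : occ w (a ++ b) <= occ w a + occ w b + minn (size a) (size w) by lia.
elim: a => [|c a IH]; first by rewrite min0n addn0.
rewrite cat_cons !occ_cons.
have [wa|wa] := leqP (size w) (size (c :: a)).
  by rewrite -cat_cons prefix_cat_size//; move: wa => /=; lia.
by move: wa => /=; have := leq_b1 (prefix w (c :: a ++ b)); lia.
Qed.

Lemma leq_occ_flatten w L : \sum_(v <- L) occ w v <= occ w (flatten L).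
Proof.
elim: L => [|v L IH]; first by rewrite big_nil.
by rewrite big_cons /=; apply: leq_trans (leq_occ_cat _ _ _); rewrite leq_add2l.
Qed.

Lemma occ_flatten_leq w L :
  occ w (flatten L) <= \sum_(v <- L) occ w v + size L * size w.
Proof.
elim: L => [|v L IH]; first by rewrite big_nil.
by rewrite big_cons /=; have := occ_cat_leq w v (flatten L); lia.
Qed.

(** A copy of [z] put in front of at least [i] others starts a new occurrence of [w], since [w] is a
    prefix of [i] copies. *)
Lemma leq_occ_nseq w z r i : 0 < size z -> i <= r ->
  prefix w (flatten (nseq i z)) -> r - i <= occ w (flatten (nseq r z)).
Proof.
move=> z0 ir wi; rewrite -{2}(subnK ir); elim: (r - i) => // j IH.
have : prefix w (z ++ flatten (nseq (j + i) z)).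
  rewrite -[_ ++ _]/(flatten (nseq (j + i).+1 z)) -addSn addnC nseqD flatten_cat.
  exact: prefix_catl.
case: z z0 IH {wi} => // c z _ IH.
rewrite addSn [nseq _.+1 _]/= [flatten (_ :: _)]/= cat_cons occ_cons => ->.
rewrite add1n ltnS; apply: leq_trans IH _.
by apply: leq_trans (leq_occ_cat _ _ _); exact: leq_addl.
Qed.

Lemma prefix_flatten_split n L z : {in L, forall v, size v = n} ->
  prefix z (flatten L) ->
  exists vs b, [/\ z = flatten vs ++ b, {subset vs <= L} & size b <= n].
Proof.
elim: L z => [|v L IH] z Ln.
  by rewrite [flatten _]/= prefixs0 => /eqP ->; exists [::], [::].
have vn : size v = n by apply: Ln; rewrite mem_head.
have [zv|vz] := leqP (size z) (size v).
  by move=> _; exists [::], z; split => //; rewrite -vn.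
rewrite [flatten _]/= prefixE => /eqP E.
have : z = v ++ take (size z - size v) (flatten L).
  by rewrite -{1}E take_cat ltnNge (ltnW vz).
move: (take _ _) (prefix_take (flatten L) (size z - size v)) => z' pz' ->.
have [|vs [b [-> sL bn]]] := IH z' _ pz'.
  by move=> y yL; apply: Ln; rewrite inE yL orbT.
exists (v :: vs), b; split => //; first by rewrite /= catA.
move=> y; rewrite !inE => /orP[->//|/sL ->]; exact: orbT.
Qed.

(** Induction on [L]: [z] starts after [v], or lies inside [v] (then [a] is all of [z]), or leaves
    [v] and goes on as a prefix of [flatten L]. *)
Lemma infix_flatten_split n L z : {in L, forall v, size v = n} ->
  infix z (flatten L) -> exists a vs b,
    [/\ z = a ++ flatten vs ++ b, {subset vs <= L}, size a <= n & size b <= n].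
Proof.
elim: L z => [|v L IH] z Ln.
  by rewrite [flatten _]/= infixs0 => /eqP ->; exists [::], [::], [::].
have vn : size v = n by apply: Ln; rewrite mem_head.
have Ln' : {in L, forall v, size v = n}.
  by move=> y yL; apply: Ln; rewrite inE yL orbT.
case/infixP => s [s' /= E].
have [sv|vs] := leqP (size v) (size s).
  have [|a [vs [b [-> sL an bn]]]] := IH z Ln'.
    apply/infixP; exists (drop (size v) s), s'.
    have := congr1 (drop (size v)) E.
    rewrite drop_size_cat// => ->; rewrite drop_cat.
    case: ltngtP sv => // sv _.
    by rewrite sv subnn drop0 drop_size.
  by exists a, vs, b; split => // y /sL; rewrite inE orbC => ->.
have Ev : v = s ++ drop (size s) v.
  rewrite -{1}(cat_take_drop (size s) v); congr (_ ++ _).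
  by have := congr1 (take (size s)) E; rewrite takel_cat ?(ltnW vs)// take_size_cat.
have {}E : drop (size s) v ++ flatten L = z ++ s'.
  have := congr1 (drop (size s)) E.
  by rewrite drop_cat vs drop_size_cat.
have dn : size (drop (size s) v) <= n by rewrite size_drop -vn; exact: leq_subr.
have [zv|vz] := leqP (size z) (size (drop (size s) v)).
  by exists z, [::], [::]; split => //=; [rewrite cats0|exact: leq_trans dn].
have Ez : z = drop (size s) v ++ drop (size (drop (size s) v)) z.
  rewrite -{1}(cat_take_drop (size (drop (size s) v)) z); congr (_ ++ _).
  by have := congr1 (take (size (drop (size s) v))) E;
    rewrite take_size_cat// takel_cat ?(ltnW vz).
have [|vs' [b [Ez' sL bn]]] :=
    @prefix_flatten_split n L (drop (size (drop (size s) v)) z) Ln'.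
  apply/prefixP; exists s'.
  by have := congr1 (drop (size (drop (size s) v))) E;
    rewrite drop_size_cat// drop_cat vz.
exists (drop (size s) v), vs', b; split => //.
- by rewrite -Ez'.
- by move=> y /sL yL; rewrite inE yL orbT.
Qed.

(** [q] is the number of whole words inside [z]. The upper bound adds a junction, hence [size w],
    for each of them, and the two cut words at the ends, with at most [n] letters and a junction
    each. *)
Lemma occ_infix_flatten n g h w L z :
    {in L, forall v, [/\ size v = n, g <= occ w v & occ w v <= h]} ->
    infix z (flatten L) ->
  exists q, [/\ q * n <= size z, size z <= (q + 2) * n, q * g <= occ w z
    & occ w z <= q * (h + size w) + 2 * (n + size w)].
Proof.
move=> Lw /(@infix_flatten_split n)[|a [vs [b [-> sL an bn]]]].
  by move=> v /Lw[].
have Lvs : {in vs, forall v, [/\ size v = n, g <= occ w v & occ w v <= h]}.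
  by move=> v /sL /Lw.
have [szvs gvs hvs] : [/\ size (flatten vs) = size vs * n,
    size vs * g <= \sum_(v <- vs) occ w v & \sum_(v <- vs) occ w v <= size vs * h].
  elim: vs Lvs {sL} => [|v vs IH] Lvs; first by rewrite big_nil.
  have [|s1 s2 s3] := IH.
    by move=> y yL; apply: Lvs; rewrite inE yL orbT.
  have [] := Lvs v (mem_head _ _).
  by rewrite big_cons /= size_cat s1; split; lia.
exists (size vs); rewrite !size_cat szvs; split; [nia|nia| |].
- have := leq_occ_flatten w vs.
  have := leq_occ_cat w a (flatten vs ++ b).
  have := leq_occ_cat w (flatten vs) b; lia.
- have := occ_flatten_leq w vs.
  have := occ_cat_leq w a (flatten vs ++ b).
  have := occ_cat_leq w (flatten vs) b.
  have := occ_size w a; have := occ_size w b; nia.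
Qed.

Definition win x i n : seq T := map x (iota i n).

Lemma size_win x i n : size (win x i n) = n.
Proof. by rewrite size_map size_iota. Qed.

Lemma win_cat x i m n : win x i (m + n) = win x i m ++ win x (i + m) n.
Proof. by rewrite /win iotaD map_cat. Qed.

Lemma win_take x i m n : m <= n -> win x i m = take m (win x i n).
Proof. by move=> /subnKC <-; rewrite win_cat take_size_cat ?size_win. Qed.

Lemma infix_win x i j m n : i <= j -> j + m <= i + n ->
  infix (win x j m) (win x i n).
Proof.
move=> ij jm; have -> : n = (j - i) + (m + (i + n - (j + m))) by lia.
by rewrite !win_cat (subnKC ij) infix_infix.
Qed.

(** Windows may reach beyond position [n], unlike in [occ w (win x 0 n)]: this makes [visits] a
    Birkhoff sum of the indicator of a cylinder, at the price of an error [size w]. *)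
Definition visits w x n : nat := \sum_(i < n) (win x i (size w) == w).

Lemma visits_occ w x n :
  occ w (win x 0 n) <= visits w x n <= occ w (win x 0 n) + size w.
Proof.
rewrite /visits -(big_mkord predT (fun i => nat_of_bool (win x i (size w) == w))).
suff : forall j, occ w (win x j n) <=
      \sum_(j <= i < j + n) (win x i (size w) == w) <=
    occ w (win x j n) + minn n (size w).
  move=> /(_ 0); rewrite add0n => /andP[-> /leq_trans]; apply.
  by rewrite leq_add2l geq_minr.
elim: n => [|n IH] i; first by rewrite addn0 big_geq ?leq0n.
rewrite big_ltn; last by lia.
have /andP[] := IH i.+1; rewrite -addSnnS.
have -> : win x i n.+1 = x i :: win x i.+1 n by [].
rewrite occ_cons.
have [wn|nw] := leqP (size w) n.+1.
  have -> : prefix w (x i :: win x i.+1 n) = (win x i (size w) == w).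
    rewrite -[_ :: _]/(win x i n.+1) -(subnK wn) addnC win_cat.
    by rewrite prefixE takel_cat ?size_win// take_oversize ?size_win.
  by move=> h1 h2; rewrite leq_add2l h1 -addnA leq_add2l; apply: leq_trans h2 _; lia.
have -> : prefix w (x i :: win x i.+1 n) = false.
  apply/negP => /size_prefix; rewrite /= size_win; lia.
by have := leq_b1 (win x i (size w) == w); lia.
Qed.

End Occurrences.

(** * The words of each stage *)

(** The product of the n factors 2n - i, i < n, each at least n, is binomial(2n, n) n!, and
    binomial(2n, n) <= 4^n. *)
Lemma expnn_leq_fact n : n ^ n <= 4 ^ n * n`!.
Proof.
have bin4 : 'C(n + n, n) <= 4 ^ n.
  rewrite (_ : 4 ^ n = 2 ^ (n + n)); last by rewrite addnn -mul2n expnM.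
  have -> : 2 ^ (n + n) = \sum_(i < (n + n).+1) 'C(n + n, i).
    rewrite -[2]/(1 + 1) expnDn; apply: eq_bigr => i _.
    by rewrite !exp1n !muln1.
  have ltn : n < (n + n).+1 by lia.
  by rewrite (bigD1 (Ordinal ltn)) //= leq_addr.
apply: leq_trans (leq_mul bin4 (leqnn _)).
rewrite bin_ffact ffact_prod.
have -> : n ^ n = \prod_(i < n) n by rewrite prod_nat_const card_ord.
by apply: leq_prod => i _; have := ltn_ord i; lia.
Qed.

Definition refine (B : seq (seq 'I_2)) : seq (seq 'I_2) :=
  let u := head [::] B in
  [seq flatten (nseq (size B %/ size u) u ++ s) | s <- permutations B].

(** The length 6 is the least n for which the set of all 2^n words satisfies [inv_num], there with
    equality. *)
Definition blocks k : seq (seq 'I_2) :=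
  iter k refine [seq tval t | t <- enum {: 6.-tuple 'I_2}].

Definition lead k : seq 'I_2 := head [::] (blocks k).
Definition len k := size (lead k).
Definition num k := size (blocks k).
Definition reps k := num k %/ len k.

Lemma blocksS k : blocks k.+1 =
  [seq flatten (nseq (reps k) (lead k) ++ s) | s <- permutations (blocks k)].
Proof. by rewrite /blocks iterS. Qed.

Lemma flatten_inj_in (T : eqType) n (s s' : seq (seq T)) : 0 < n ->
  {in s, forall v, size v = n} -> {in s', forall v, size v = n} ->
  flatten s = flatten s' -> s = s'.
Proof.
move=> n0; elim: s s' => [|v s IH] [|v' s'] //.
- move=> _ /(_ v' (mem_head _ _)) vn /esym /(congr1 size); rewrite size_cat /=; lia.
- move=> /(_ v (mem_head _ _)) vn _ /(congr1 size); rewrite size_cat /=; lia.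
move=> sn s'n /= /eqP.
rewrite eqseq_cat; last by rewrite sn ?mem_head// s'n ?mem_head.
case/andP => /eqP -> /eqP /IH -> // y ys.
- by apply: sn; rewrite inE ys orbT.
- by apply: s'n; rewrite inE ys orbT.
Qed.

(* [inv_num] says that log2 N_k >= n_k / 2 + 3; the added 3 makes up for the
   factor 4 ^ N_k lost in [expnn_leq_fact] and for the repetitions. *)
Record blocks_inv k : Prop := BlocksInv {
  inv_uniq : uniq (blocks k);
  inv_size : {in blocks k, forall v, size v = len k};
  inv_len : k < len k;
  inv_num : 2 ^ (len k + 6) <= num k ^ 2
}.

Lemma num0E : num 0 = 64.
Proof. by rewrite /num size_map -cardE card_tuple card_ord. Qed.

Lemma size_block0 : {in blocks 0, forall v, size v = 6}.
Proof. by move=> v /mapP[t _ ->]; rewrite size_tuple. Qed.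

Lemma len0E : len 0 = 6.
Proof. by apply: size_block0; rewrite /lead -nth0 mem_nth// -/(num 0) num0E. Qed.

Lemma inv_base : blocks_inv 0.
Proof.
split; rewrite ?len0E ?num0E //; last exact: size_block0.
by rewrite map_inj_uniq ?enum_uniq//; exact: val_inj.
Qed.

Lemma sqrn_leq_exp n : n ^ 2 <= 2 ^ (n + 2).
Proof.
elim: n => // n IH.
case: (leqP n 2) => [|n2]; last first.
  rewrite addSn (expnS 2).
  apply: (@leq_trans (2 * n ^ 2)); last by rewrite leq_mul2l IH.
  by rewrite -!mulnn; nia.
by case: n {IH} => [|[|[|]]].
Qed.

(** The second bound yields at least two repetitions, so that [(reps k)./2] is positive. *)
Lemma inv_reps k : blocks_inv k -> 8 <= num k /\ 2 * len k <= num k.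
Proof.
case=> _ _ _ h; split.
  rewrite -(leq_exp2r _ _ (isT : 0 < 2)); apply: leq_trans h.
  by rewrite (_ : 8 ^ 2 = 2 ^ 6)// leq_pexp2l// leq_addl.
rewrite -(leq_exp2r _ _ (isT : 0 < 2)); apply: leq_trans h.
rewrite expnMn; apply: leq_trans (leq_mul (leqnn _) (sqrn_leq_exp _)) _.
by rewrite -expnD leq_pexp2l//; lia.
Qed.

Lemma blocksSP k v : reflect (exists2 s, perm_eq s (blocks k) &
    v = flatten (nseq (reps k) (lead k) ++ s)) (v \in blocks k.+1).
Proof.
rewrite blocksS; apply: (iffP mapP) => -[s ps ->]; exists s => //.
  by rewrite -mem_permutations.
by rewrite mem_permutations.
Qed.

Lemma size_flatten_const (T : eqType) n (s : seq (seq T)) :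
  {in s, forall v, size v = n} -> size (flatten s) = size s * n.
Proof.
elim: s => // v s IH sn; rewrite /= size_cat IH.
  by rewrite sn ?mem_head// mulSn.
by move=> y ys; apply: sn; rewrite inE ys orbT.
Qed.

Lemma lead_in k : 0 < num k -> lead k \in blocks k.
Proof. by move=> h; rewrite /lead -nth0 mem_nth. Qed.

Lemma refine_sub k s : 0 < num k -> perm_eq s (blocks k) ->
  {subset nseq (reps k) (lead k) ++ s <= blocks k}.
Proof.
move=> k0 ps v; rewrite mem_cat mem_nseq => /orP[/andP[_ /eqP ->]|].
  exact: lead_in.
by rewrite (perm_mem ps).
Qed.

Lemma inv_step_size k : blocks_inv k ->
  {in blocks k.+1, forall v, size v = (reps k + num k) * len k}.
Proof.
move=> ik v /blocksSP[s ps ->]; have [n8 _] := inv_reps ik.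
rewrite (@size_flatten_const _ (len k)).
  by rewrite size_cat size_nseq (perm_size ps).
move=> y /(refine_sub _ ps) yk; apply: inv_size => //; apply: yk; lia.
Qed.

Lemma uniq_blocksS k : blocks_inv k -> uniq (blocks k.+1).
Proof.
move=> ik; have [n8 _] := inv_reps ik.
rewrite blocksS map_inj_in_uniq ?permutations_uniq// => s s'.
rewrite !mem_permutations => ps ps'; rewrite !flatten_cat => /eqP.
rewrite eqseq_cat// => /andP[_ /eqP]; apply: (@flatten_inj_in _ (len k)).
- have := inv_len ik; lia.
- by move=> v; rewrite (perm_mem ps) => /(inv_size ik).
- by move=> v; rewrite (perm_mem ps') => /(inv_size ik).
Qed.

Lemma numS k : blocks_inv k -> num k.+1 = (num k)`!.
Proof.
move=> ik; rewrite /num blocksS size_map size_permutations//; exact: inv_uniq.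
Qed.

Lemma lenS k : blocks_inv k -> len k.+1 = (reps k + num k) * len k.
Proof.
by move=> ik; apply: inv_step_size => //; apply: lead_in; rewrite numS// fact_gt0.
Qed.

Lemma leq_repsM k : reps k * len k <= num k.
Proof. exact: leq_divM. Qed.

(** After multiplication by the square of [4 ^ num k], [expnn_leq_fact] and [inv_num] reduce the
    bound on [num k.+1] to the inequality of exponents 4 N + (r + N) n + 6 <= (n + 6) N, which
    follows from r n <= N and N >= 8. *)
Lemma invS k : blocks_inv k -> blocks_inv k.+1.
Proof.
move=> ik; have [n8 n2] := inv_reps ik; have kl := inv_len ik.
split.
- exact: uniq_blocksS.
- by move=> v /(inv_step_size ik) ->; rewrite lenS.
- by rewrite lenS//; nia.
rewrite numS// -(leq_pmul2l (_ : 0 < 4 ^ num k * 4 ^ num k)); last first.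
  by rewrite muln_gt0 !expn_gt0.
have := leq_mul (expnn_leq_fact (num k)) (expnn_leq_fact (num k)).
have -> : 4 ^ num k * (num k)`! * (4 ^ num k * (num k)`!) =
  4 ^ num k * 4 ^ num k * (num k)`! ^ 2 by rewrite -mulnn mulnACA.
apply: leq_trans.
have -> : 4 ^ num k * 4 ^ num k = 2 ^ (4 * num k).
  by rewrite -expnD addnn -mul2n (_ : 4 = 2 ^ 2)// -expnM mulnA.
rewrite -[num k ^ num k * _]expnMn mulnn.
have := inv_num ik; rewrite -(leq_exp2r _ _ (_ : 0 < num k)); last by lia.
apply: leq_trans; rewrite -expnM -expnD leq_pexp2l// lenS//.
have := leq_repsM k; nia.
Qed.

Lemma blocks_invP k : blocks_inv k.
Proof. by elim: k => [|k /invS//]; exact: inv_base. Qed.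

Lemma len_gt0 k : 0 < len k.
Proof. by have := inv_len (blocks_invP k); lia. Qed.

Lemma num_ge8 k : 8 <= num k.
Proof. by have [] := inv_reps (blocks_invP k). Qed.

Lemma num_gt0 k : 0 < num k.
Proof. by have := num_ge8 k; lia. Qed.

Lemma reps_ge2 k : 2 <= reps k.
Proof. by rewrite leq_divRL ?len_gt0//; have [] := inv_reps (blocks_invP k). Qed.

Lemma size_block k v : v \in blocks k -> size v = len k.
Proof. exact: inv_size (blocks_invP k) v. Qed.

Lemma lead_block k : lead k \in blocks k.
Proof. exact: lead_in (num_gt0 k). Qed.

(** The tail of [v'] is an ordering of all words of stage [k]: this is the source of minimality. *)
Lemma infix_blockS k v v' : v \in blocks k -> v' \in blocks k.+1 -> infix v v'.
Proof.
move=> vk /blocksSP[s ps ->]; move: vk; rewrite -(perm_mem ps) flatten_cat.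
move=> /splitPr[s1 s2]; rewrite flatten_cat catA.
by apply/infixP; eexists; eexists.
Qed.

Lemma infix_block k j v v' :
  v \in blocks k -> v' \in blocks (k + j).+1 -> infix v v'.
Proof.
elim: j v' => [|j IH] v' vk v'k.
  by rewrite addn0 in v'k; exact: infix_blockS v'k.
rewrite addnS in v'k; apply: infix_trans (infix_blockS (lead_block _) v'k).
exact: IH (lead_block _).
Qed.

Lemma block_flatten k j v : v \in blocks (k + j) ->
  exists2 L, {subset L <= blocks k} & v = flatten L.
Proof.
elim: j v => [|j IH] v.
  rewrite addn0 => vk; exists [:: v]; last by rewrite /= cats0.
  by move=> y; rewrite inE => /eqP ->.
rewrite addnS => /blocksSP[s ps ->].
have : {subset nseq (reps (k + j)) (lead (k + j)) ++ s <= blocks (k + j)}.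
  exact: refine_sub (num_gt0 _) ps.
elim: (_ ++ s) => [|y L IHL] sub; first by exists [::].
have [|L1 sL1 ->] := IH y; first by apply: sub; rewrite mem_head.
have [|L2 sL2 /= ->] := IHL; first by move=> z zL; apply: sub; rewrite inE zL orbT.
exists (L1 ++ L2); last by rewrite flatten_cat.
by move=> z; rewrite mem_cat => /orP[/sL1|/sL2].
Qed.

(** * The language of the subshift *)

(** Windows from 0 suffice, as every other window lies in one of them. Each condition involves
    finitely many letters, so the set is closed. *)
Definition admissible (x : nat -> 'I_2) :=
  forall n, exists k, exists2 v, v \in blocks k & infix (win x 0 n) v.

(** The stage [j] of the given word may be below [k], but that word occurs in [lead (k + j).+1],
    which is a concatenation of words of stage [k]. *)
Lemma admissible_flatten x k n : admissible x ->
  exists2 L, {subset L <= blocks k} & infix (win x 0 n) (flatten L).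
Proof.
move=> /(_ n)[j [v vj xv]].
have [L sL E] : exists2 L, {subset L <= blocks k} & lead (k + j).+1 = flatten L.
  by apply: (@block_flatten _ j.+1); rewrite addnS lead_block.
exists L => //; rewrite -E; apply: infix_trans xv _.
by apply: (@infix_block j k) => //; rewrite addnC lead_block.
Qed.

Lemma prefix_leadS k : prefix (lead k) (lead k.+1).
Proof.
have /blocksSP[s _ ->] := lead_block k.+1.
case: (reps k) (reps_ge2 k) => // r _.
exact: prefix_prefix.
Qed.

Lemma prefix_lead k j : prefix (lead k) (lead (k + j)).
Proof.
elim: j => [|j IH]; first by rewrite addn0 prefix_refl.
by rewrite addnS; exact: prefix_trans IH (prefix_leadS _).
Qed.

(** The words [lead k] are prefixes of one another and [lead i] has more than [i] letters, so this
    is their common infinite extension. *)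
Definition limit_point (i : nat) : 'I_2 := nth ord0 (lead i) i.

Lemma win_limit_point k : win limit_point 0 (len k) = lead k.
Proof.
apply: (@eq_from_nth _ ord0) => [|i]; first by rewrite size_win.
rewrite size_win => ik; rewrite (nth_map 0) ?size_iota// nth_iota// add0n.
rewrite /limit_point; have il := inv_len (blocks_invP i).
have [ki|/ltnW ki] := leqP k i.
  have /prefixP[s] := prefix_lead k (i - k); rewrite subnKC// => ->.
  by rewrite nth_cat ik.
have /prefixP[s] := prefix_lead i (k - i); rewrite subnKC// => ->.
by rewrite nth_cat il.
Qed.

Lemma admissible_limit_point : admissible limit_point.
Proof.
move=> n; exists n, (lead n); first exact: lead_block.
rewrite -win_limit_point; apply: infix_win => //.
by rewrite leq_add2l ltnW// inv_len//; exact: blocks_invP.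
Qed.

Lemma win_shift (x : nat -> 'I_2) i n j :
  win (fun l => x (l + j)) i n = win x (i + j) n.
Proof.
by rewrite /win addnC iotaDl -map_comp; apply: eq_map => l /=; rewrite addnC.
Qed.

Lemma admissible_shift x j : admissible x -> admissible (fun l => x (l + j)).
Proof.
move=> ax n; have [k [v vk xv]] := ax (j + n).
exists k, v => //; apply: infix_trans xv.
rewrite win_shift; exact: infix_win.
Qed.

Lemma infix_win_ex (T : eqType) (x : nat -> T) z n : infix z (win x 0 n) ->
  exists2 i, z = win x i (size z) & i + size z <= n.
Proof.
case/infixP => a [b E]; exists (size a).
  have := congr1 size E; rewrite size_win !size_cat => En.
  move: E; rewrite En !win_cat add0n => /eqP.
  rewrite eqseq_cat ?size_win// => /andP[_].
  rewrite eqseq_cat ?size_win// => /andP[/eqP <- _].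
  by rewrite size_win.
by have := congr1 size E; rewrite size_win !size_cat; lia.
Qed.

(** The two cut ends cover at most [2 * len k] letters of the window, so it contains a whole
    word. *)
Lemma admissible_infix x k : admissible x ->
  exists2 v, v \in blocks k & infix v (win x 0 (3 * len k)).
Proof.
move=> ax; have [L sL] := admissible_flatten k (3 * len k) ax.
move=> /(@infix_flatten_split _ (len k))[|a [[|v vs] [b [E svs an bn]]]].
- by move=> v /sL; exact: size_block.
- have := congr1 size E; rewrite size_win !size_cat /= add0n => E3.
  have := leq_add an bn;
  by rewrite -E3 addnn -mul2n leq_pmul2r ?len_gt0.
exists v; first by apply/sL/svs; rewrite mem_head.
by rewrite E /= -!catA infix_infix.
Qed.

Lemma admissible_recurrent x y n : admissible x -> admissible y ->
  exists i, win x i n = win y 0 n.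
Proof.
move=> ax ay; have [k [v vk yv]] := ay n.
have [V Vk Vx] := admissible_infix k.+1 ax.
have h : infix (win y 0 n) (win x 0 (3 * len k.+1)).
  exact: infix_trans yv (infix_trans (infix_blockS vk Vk) Vx).
by have [i E _] := infix_win_ex h; exists i; rewrite E size_win.
Qed.

Lemma block_seen k v : v \in blocks k -> exists i, win limit_point i (len k) = v.
Proof.
move=> vk; have h := infix_blockS vk (lead_block k.+1).
rewrite -win_limit_point in h.
by have [i E _] := infix_win_ex h; exists i; rewrite [RHS]E (size_block vk).
Qed.

Lemma visits_bounds k g h w x n : admissible x ->
    {in blocks k, forall v, g <= occ w v <= h} ->
  exists q, [/\ q * len k <= n, n <= (q + 2) * len k, q * g <= visits w x n
    & visits w x n <= q * (h + size w) + 2 * (len k + size w) + size w].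
Proof.
move=> ax gh; have [L sL xL] := admissible_flatten k n ax.
have [|q []] := @occ_infix_flatten _ (len k) g h w L _ _ xL.
  by move=> v /sL vk; have /andP[] := gh v vk; rewrite (size_block vk).
rewrite size_win => q1 q2 q3 q4; exists q.
have /andP[] := visits_occ w x n; split; lia.
Qed.

(** The sum over the constituent words is the same for every order; only the junctions, at most
    [size w] occurrences for each constituent, depend on it. *)
Lemma occ_blockS w k : exists S, {in blocks k.+1, forall v,
  S <= occ w v <= S + (reps k + num k) * size w}.
Proof.
exists (\sum_(v <- nseq (reps k) (lead k) ++ blocks k) occ w v).
move=> v /blocksSP[s ps ->].
set L := nseq _ _ ++ s.
have -> : \sum_(v <- nseq (reps k) (lead k) ++ blocks k) occ w v =
    \sum_(v <- L) occ w v.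
  by apply: perm_big; rewrite perm_cat2l perm_sym.
have -> : reps k + num k = size L by rewrite size_cat size_nseq (perm_size ps).
by rewrite leq_occ_flatten occ_flatten_leq.
Qed.

(** Here N < (r + 1) n, and r + 1 <= 4 floor(r/2) for r >= 2, with equality at r = 3. *)
Lemma num_leq_half_reps k : num k <= 4 * ((reps k)./2 * len k).
Proof.
have := ltn_ceil (num k) (len_gt0 k); rewrite -/(reps k) => h.
apply: leq_trans (ltnW h) _; rewrite mulnA leq_mul2r; apply/orP; right.
have := reps_ge2 k; have := odd_double_half (reps k).
by have := leq_b1 (odd (reps k)); rewrite -muln2; lia.
Qed.

(** Let r, n, N be the values at the stage [k] found below and h = floor(r/2). The word, a prefix of
    h copies of [lead k], starts at h copies or more in each word of stage [k.+1], whose length is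
    at most 2 N n <= 8 h n^2. With n <= 6 (m+1)^2 this gives 288 = 8 * 36. *)
Lemma frequent_word m : exists w k, [/\ size w = m, 0 < len k
  & {in blocks k, forall v, len k <= 288 * m.+1 ^ 4 * occ w v}].
Proof.
have ex : exists k, m <= (reps k)./2 * len k.
  exists m; have := inv_len (blocks_invP m).
  move=> /ltnW ml; apply: leq_trans ml _.
  by rewrite leq_pmull// half_gt0 reps_ge2.
(* For the least such [k], [m] is at least of the order of [num k.-1], hence
   [len k <= 6 * m.+1 ^ 2] (below). *)
have [k mk kmin] := ex_minnP ex.
pose u := flatten (nseq (reps k)./2 (lead k)).
have szu : size u = (reps k)./2 * len k.
  rewrite (@size_flatten_const _ (len k)) ?size_nseq// => v.
  by rewrite mem_nseq => /andP[_ /eqP ->].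
exists (take m u), k.+1; rewrite size_takel ?szu// len_gt0; split => // v.
move=> /blocksSP[s _ ->]; rewrite flatten_cat.
have hr : (reps k)./2 <= reps k by rewrite -divn2 leq_div.
have h1 := leq_occ_nseq (len_gt0 k) hr (prefix_take u m).
have h2 := leq_occ_cat (take m u) (flatten (nseq (reps k) (lead k))) (flatten s).
have {h1 h2} := leq_trans (leq_trans h1 (leq_addr _ _)) h2.
set o := occ _ _ => h1; have {}h1 : (reps k)./2 <= o.
  by apply: leq_trans h1; have := odd_double_half (reps k); rewrite -muln2; lia.
rewrite lenS; last exact: blocks_invP.
(* The 6 is [len 0]; at later stages the minimality of [k] gives 4 m (m+1). *)
have lk : len k <= 6 * m.+1 ^ 2.
  case: k kmin {mk u szu hr o h1} => [_|k kmin].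
    by rewrite len0E leq_pmulr// expn_gt0.
  have mk : (reps k)./2 * len k < m.
    rewrite ltnNge; apply/negP => /kmin; lia.
  rewrite lenS; last exact: blocks_invP.
  have Nm : num k <= 4 * m by apply: leq_trans (num_leq_half_reps k) _; lia.
  have lm : len k <= m.
    by apply: leq_trans (ltnW mk); rewrite leq_pmull// half_gt0 reps_ge2.
  have Nl : (reps k + num k) * len k <= num k * (len k).+1.
    by rewrite mulnDl mulnS leq_add2r leq_repsM.
  apply: leq_trans Nl (leq_trans (leq_mul Nm (lm : (len k).+1 <= m.+1)) _).
  by rewrite -mulnn; nia.
have Nh := num_leq_half_reps k; have l0 := len_gt0 k.
have Nl : (reps k + num k) * len k <= num k * (2 * len k).
  rewrite mulnDl; have := leq_repsM k; nia.
rewrite -[4]/(2 * 2) expnM; move: (m.+1 ^ 2) lk => M lk.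
apply: leq_trans Nl (leq_trans (leq_mul Nh (leqnn _)) _).
have ll := leq_mul lk lk.
apply: (@leq_trans (8 * (reps k)./2 * (len k * len k))); first by nia.
apply: leq_trans (leq_mul (leqnn _) ll) _.
apply: (@leq_trans (288 * M ^ 2 * (reps k)./2)); first by rewrite -mulnn; nia.
by rewrite leq_mul2l h1 orbT.
Qed.

Local Open Scope classical_set_scope.
Local Open Scope ring_scope.

(** * Cylinders, topology and Borel sets *)

Section Cylinders.
Context {R : realType}.
Local Notation S := (Sigma R 0).
Implicit Types (x y : S) (w : seq 'I_2) (n m k : nat).

Definition cylinder w : set S := [set x | win x 0 (size w) = w].

Lemma iter_shiftE i x : iter i shift_map x = fun l => x (l + i)%N.
Proof.
elim: i => [|i IH]; first by apply/funext => l; rewrite addn0.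
by apply/funext => l; rewrite iterS IH /shift_map addSnnS.
Qed.

Lemma win_iter_shift i x j n : win (iter i shift_map x) j n = win x (i + j) n.
Proof. by rewrite iter_shiftE win_shift addnC. Qed.

Lemma eq_winP x y n :
  win x 0 n = win y 0 n <-> forall i, (i < n)%N -> x i = y i.
Proof.
split=> [E i ni|E]; last first.
  by apply/eq_in_map => i; rewrite mem_iota add0n => /E.
have := congr1 (fun s => nth ord0 s i) E.
by rewrite !(nth_map 0%N) ?size_iota// !nth_iota.
Qed.

Lemma rho_leP x y eps : 0 <= eps ->
  mdist x y <= eps <-> forall j, eps < 2 ^- j -> x j = y j.
Proof.
move=> e0; split=> [xy j ej|xy].
  apply/eqP; apply: contraT => /(@rho_le R) h.
  by have := lt_le_trans ej (le_trans h xy); rewrite ltxx.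
rewrite /mdist/= /rho; case: pselect => // h.
case: ex_minnP => k xyk _; rewrite leNgt; apply/negP => /xy E.
by rewrite E eqxx in xyk.
Qed.

Lemma eq_win_mdist x y n : win x 0 n = win y 0 n -> mdist x y <= 2 ^- n.
Proof.
move=> /eq_winP E; apply/rho_leP => [|j]; first by rewrite invr_ge0 exprn_ge0.
rewrite ltf_pV2 ?posrE ?exprn_gt0// ltr_eXn2l ?ltr1n// => /E; exact.
Qed.

Lemma mdist_eq_win x y n : mdist x y < 2 ^- n -> win x 0 n = win y 0 n.
Proof.
move=> xy; apply/eq_winP => i /ltnW ni.
have /rho_leP : mdist x y <= mdist x y by [].
apply; first exact: mdist_ge0.
apply: lt_le_trans xy _.
by rewrite lef_pV2 ?posrE ?exprn_gt0// ler_eXn2l ?ltr1n.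
Qed.

Lemma exp2V_lt eps : 0 < eps -> exists n, 2 ^- n < eps :> R.
Proof.
move=> e0; have [n n0 ne] : exists2 n, (0 < n)%N & n%:R^-1 < eps.
  have [n ne] := ltr_add_invr e0; exists n.+1 => //.
  by rewrite add0r in ne.
exists n; apply: le_lt_trans ne.
by rewrite lef_pV2 ?posrE ?exprn_gt0 ?ltr0n// -natrX ler_nat ltnW// ltn_expl.
Qed.

Lemma nbhs_cylinder x n : nbhs x (cylinder (win x 0 n)).
Proof.
apply/nbhs_ballP; exists (2 ^- n); first by rewrite /= invr_gt0 exprn_gt0.
by move=> y; rewrite ballEmdist /cylinder/= size_win => /mdist_eq_win ->.
Qed.

Lemma nbhs_cylinderP x (A : set S) :
  nbhs x A <-> exists n, cylinder (win x 0 n) `<=` A.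
Proof.
split=> [/nbhs_ballP[e /= e0 xeA]|[n]]; last first.
  by move/filterS; apply; exact: nbhs_cylinder.
have [n ne] := exp2V_lt e0; exists n => y; rewrite /cylinder/= size_win => E.
by apply: xeA; rewrite ballEmdist/=; apply: le_lt_trans ne; apply: eq_win_mdist.
Qed.

Lemma open_cylinder w : open (cylinder w).
Proof.
rewrite openE => x xw; apply/nbhs_cylinderP; exists (size w) => y.
by rewrite /cylinder/= size_win => ->.
Qed.

Lemma cylinder_nil : cylinder [::] = setT.
Proof. by apply/seteqP; split. Qed.

Lemma cylinderI w w' : cylinder w `&` cylinder w' = set0 \/
  exists v, cylinder w `&` cylinder w' = cylinder v.
Proof.
wlog ww' : w w' / (size w <= size w')%N.
  by move=> h; have [/h//|/ltnW/h] := leqP (size w) (size w'); rewrite setIC.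
have [E|E] := eqVneq (take (size w) w') w; [right; exists w'|left].
  apply/seteqP; split=> x //= [] // xw'; split => //.
  by rewrite /cylinder/= (win_take _ _ ww') xw'.
apply/seteqP; split=> x //= [xw xw']; move/eqP: E; apply.
by rewrite -[in LHS]xw' -win_take.
Qed.

Definition cylinders : set (set S) := [set A | A = set0 \/ exists w, A = cylinder w].

Lemma setI_closed_cylinders : setI_closed cylinders.
Proof.
move=> A B [->|[w ->]]; first by left; rewrite set0I.
move=> [->|[w' ->]]; first by left; rewrite setI0.
by have [->|[v ->]] := cylinderI w w'; [left|right; exists v].
Qed.

Lemma open_bigcup_cylinder (U : set S) : open U ->
  U = \bigcup_(w in [set w | cylinder w `<=` U]) cylinder w.
Proof.
rewrite openE => oU.
apply/seteqP; split=> [x /oU/nbhs_cylinderP[n xU]|x [w /= wU] /wU//].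
by exists (win x 0 n) => //; rewrite /cylinder/= size_win.
Qed.

(** There are countably many words, so the union in [open_bigcup_cylinder] is countable. *)
Lemma borel_cylinders : @measurable _ (borel S) = <<s cylinders >>.
Proof.
apply/seteqP; split.
  apply: smallest_sub; first exact: smallest_sigma_algebra.
  move=> U oU; rewrite (open_bigcup_cylinder oU) bigcup_mkcond.
  apply: (@countable_bigcupT_measurable _ (g_sigma_algebraType cylinders)) => // w.
  case: ifP => _; last exact: measurable0.
  by apply: sub_sigma_algebra; right; exists w.
apply: smallest_sub; first exact: sigma_algebra_measurable.
move=> _ [->|[w ->]]; first exact: measurable0.
by apply: sub_sigma_algebra; exact: open_cylinder.
Qed.

Lemma measurable_cylinder w : measurable (cylinder w : set (borel S)).
Proof. by apply: sub_sigma_algebra; exact: open_cylinder. Qed.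

Lemma cylinder_measure_unique (mu nu : probability (borel S) R) :
  (forall w, mu (cylinder w) = nu (cylinder w)) ->
  forall A : set (borel S), measurable A -> mu A = nu A.
Proof.
move=> munu A mA.
apply: (@measure_unique _ R (borel S) cylinders (fun=> setT)) => //.
- exact: borel_cylinders.
- exact: setI_closed_cylinders.
- by move=> _; right; exists [::]; rewrite cylinder_nil.
- by apply/seteqP; split => // x _; exists 0%N.
- by move=> B [->|[w ->]]; [rewrite !measure0|exact: munu].
- by move=> _; rewrite (le_lt_trans (probability_le1 _ _))// ltry.
Qed.

Lemma measurable_fun_cylinder d (T : measurableType d) (f : T -> borel S) :
  (forall w, measurable (f @^-1` cylinder w)) -> measurable_fun setT f.
Proof.
move=> mf.
apply: (@measurability _ _ T (borel S) setT f cylinders borel_cylinders).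
move=> _ [A [->|[w ->]] <-].
  by rewrite preimage_set0 setI0.
by rewrite setTI.
Qed.

Lemma preimage_shift_cylinder w :
  shift_map @^-1` cylinder w =
  cylinder (ord0 :: w) `|` cylinder (ord_max :: w).
Proof.
have E x a : cylinder (a :: w) x <-> x 0%N = a /\ cylinder w (shift_map x).
  rewrite /cylinder/= -[shift_map x]/(iter 1 shift_map x) win_iter_shift.
  by split=> [[<- h]|[<- h]] //; congr (_ :: _).
apply/seteqP; split=> x /=; last by case=> /E[].
move=> xw; have [h|h] : x 0%N = ord0 \/ x 0%N = ord_max.
- by case: (x 0%N) => -[|[|//]] i; [left|right]; apply/val_inj.
- by left; apply/E.
- by right; apply/E.
Qed.

Lemma measurable_shift : measurable_fun setT (shift_map : borel S -> borel S).
Proof.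
apply: measurable_fun_cylinder => w; rewrite preimage_shift_cylinder.
by apply: measurableU; exact: measurable_cylinder.
Qed.

End Cylinders.

(** * Minimality and frequencies *)

Section BlockShift.
Context {R : realType}.
Local Notation S := (Sigma R 0).
Implicit Types (x y : S) (w : seq 'I_2) (n m k : nat) (mu nu : probability (borel S) R).

Definition block_shift : set S := [set x | admissible x].

Lemma admissible_iter x i : admissible x -> admissible (iter i shift_map x).
Proof. by rewrite iter_shiftE; exact: admissible_shift. Qed.

Lemma subshift_block_shift : subshift block_shift.
Proof.
split; first by exists limit_point; exact: admissible_limit_point.
- move=> x xX n; have [y [yX]] := xX _ (nbhs_cylinder x n).
  by rewrite /cylinder/= size_win => <-; exact: yX.
- by move=> _ [x xX <-]; exact: (@admissible_iter x 1).
Qed.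

Lemma minimal_block_shift : minimal_system block_shift shift_map.
Proof.
move=> A AX cA [x Ax] sA; apply/seteqP; split=> // y yX.
apply: cA => U /nbhs_cylinderP[n yU].
have [i E] := @admissible_recurrent x y n (AX _ Ax) yX.
exists (iter i shift_map x); split.
  by elim: i {E} => // i IH; apply: sA; exists (iter i shift_map x).
by apply: yU; rewrite /cylinder/= size_win win_iter_shift addn0.
Qed.

(** Every word of stage [k.+1] contains [w] about [s] times, up to junctions. These cost a
    proportion of at most 2 m / [len k], which the choice of [k] makes at most e/2; the cut ends
    cost at most c / n, which the choice of [N] makes at most e/2. The value [a] still depends on
    [e]. *)
Lemma visits_osc w (e : R) : 0 < e -> exists a : R, exists N,
  forall n x, (N <= n)%N -> admissible x -> `|(visits w x n)%:R / n%:R - a| <= e.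
Proof.
move=> e0; set m := size w.
have [k km] : exists k, (4 * m)%:R <= e * (len k)%:R :> R.
  exists (Num.bound ((4 * m)%:R / e)); rewrite mulrC -ler_pdivrMr//.
  have := archi_boundP (divr_ge0 (ler0n R (4 * m)) (ltW e0)).
  move=> /ltW/le_trans; apply; rewrite ler_nat ltnW//; exact: inv_len (blocks_invP _).
have [s sk] := occ_blockS w k.
set l := len k.+1; have l0 : (0 < l)%N := len_gt0 _.
set c := (2 * l + 3 * m)%N.
exists (s%:R / l%:R), (Num.bound (2 * c%:R / e)).+1 => n x Nn ax.
have n0 : (0 < n)%N by exact: leq_trans Nn.
have cn : 2 * c%:R <= e * n%:R.
  rewrite mulrC [e * _]mulrC -ler_pdivrMr//.
  have := archi_boundP (divr_ge0 (ler0n R (2 * c)) (ltW e0)).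
  rewrite natrM [c%:R * _]mulrC => /ltW/le_trans; apply; rewrite ler_nat.
  by apply: leq_trans Nn; exact: leqnSn.
have [q [q1 q2 q3 q4]] := visits_bounds n ax sk.
have sl : (s <= l)%N.
  have /andP[h _] := sk _ (lead_block _); exact: leq_trans h (occ_size _ _).
have T2 : ((reps k + num k) * len k = l)%N by rewrite /l lenS//; exact: blocks_invP.
have T0 : (0 < reps k + num k)%N by rewrite addn_gt0 num_gt0 orbT.
move: (visits w x n) q3 q4 => v; rewrite -/m => q3 q4.
set T := (reps k + num k)%N in T2 T0 q4.
have lo : (s * n <= v * l + l * c)%N.
  apply: leq_trans (leq_mul (leqnn s) q2) _.
  have -> : (s * ((q + 2) * l) = q * s * l + l * (2 * s))%N by lia.
  by rewrite leq_add ?leq_mul// /c; lia.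
have hi : (v * l <= s * n + n * (2 * m * T) + l * c)%N.
  apply: leq_trans (leq_mul q4 (leqnn l)) _.
  have -> : ((q * (s + T * m + m) + 2 * (l + m) + m) * l =
    s * (q * l) + q * l * (T * m + m) + l * c)%N by rewrite /c; lia.
  by rewrite leq_add2r leq_add ?leq_mul//; nia.
clearbody c T l.
have nR : 0 < n%:R :> R by rewrite ltr0n.
have lR : 0 < l%:R :> R by rewrite ltr0n.
have -> : v%:R / n%:R - s%:R / l%:R = (v%:R * l%:R - s%:R * n%:R) / (n%:R * l%:R) :> R.
  by field; rewrite !gt_eqF.
rewrite normrM normfV (gtr0_norm (mulr_gt0 nR lR)) ler_pdivrMr ?mulr_gt0//.
have {}km : n%:R * (2 * m%:R * T%:R) <= e / 2 * (n%:R * l%:R) :> R.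
  have : 2 * m%:R <= e / 2 * (len k)%:R by move: km; rewrite natrM; lra.
  rewrite -T2 natrM => h; 
  rewrite [X in X <= _](_ : _ = 2 * m%:R * (n%:R * T%:R)); last by ring.
  rewrite [X in _ <= X](_ : _ = e / 2 * (len k)%:R * (n%:R * T%:R)); last by field.
  by rewrite ler_wpM2r ?mulr_ge0.
have {}cn : l%:R * c%:R <= e / 2 * (n%:R * l%:R).
  have : c%:R <= e / 2 * n%:R by lra.
  by move=> h; rewrite mulrC mulrA ler_pM2r.
move: lo hi; rewrite -!(ler_nat R) !(natrD, natrM) => lo hi.
by rewrite ler_norml; apply/andP; split; lra.
Qed.

(** By [visits_osc] the frequencies along [limit_point] form a Cauchy sequence; its limit is within
    e/2 of the same [a] as the frequencies in all other points. *)
Lemma visits_uniform w : exists p : R, forall e, 0 < e -> exists N,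
  forall n x, (N <= n)%N -> admissible x -> `|(visits w x n)%:R / n%:R - p| <= e.
Proof.
pose u n : R := (visits w limit_point n)%:R / n%:R.
have cu : cvg (u @ \oo).
  apply/cauchy_cvgP; apply: cauchy_exP => e e0.
  have e20 : 0 < e / 2 by rewrite divr_gt0.
  have [a [N aN]] := visits_osc w e20; exists a.
  exists N => // n /= Nn; rewrite -ball_normE /= distrC.
  apply: (@le_lt_trans _ _ (e / 2)); last by rewrite gtr_pMr// invf_lt1 ?ltr1n.
  by apply: aN => //; exact: admissible_limit_point.
exists (lim (u @ \oo)) => e e0.
have e20 : 0 < e / 2 by rewrite divr_gt0.
have [a [N aN]] := visits_osc w e20; exists N => n x Nn ax.
have : `|lim (u @ \oo) - a| <= e / 2.
  have h : `|u n - a| @[n --> \oo] --> `|lim (u @ \oo) - a|.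
    by apply: cvg_norm; apply: cvgB => //; exact: cvg_cst.
  rewrite -(cvg_lim _ h)//; apply: limr_le; first by apply/cvg_ex; eexists; exact: h.
  near=> j; apply: aN; last exact: admissible_limit_point.
  by near: j; exact: nbhs_infty_ge.
have := aN n x Nn ax; move: (lim _) ((visits w x n)%:R / n%:R) => p z h1 h2.
rewrite [e]splitr -[z - p](subrKA a) (le_trans (ler_normD _ _))// lerD//.
by rewrite distrC.
Unshelve. all: by end_near. Qed.

Definition freq w : R := projT1 (cid (visits_uniform w)).

Lemma freq_uniform w e : 0 < e -> exists N, forall n x, (N <= n)%N ->
  admissible x -> `|(visits w x n)%:R / n%:R - freq w| <= e.
Proof. by rewrite /freq; case: cid => p /= h /h. Qed.

Lemma freq_cvg w x : admissible x ->
  (visits w x n)%:R / n%:R @[n --> \oo] --> freq w.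
Proof.
move=> ax; apply/cvgrPdist_le => e e0; have [N h] := freq_uniform w e0.
near=> n; rewrite distrC; apply: h => //.
by near: n; exact: nbhs_infty_ge.
Unshelve. all: by end_near. Qed.

Arguments freq_cvg w {x}.

Lemma freq_ge0 w : 0 <= freq w.
Proof.
have h := freq_cvg w admissible_limit_point.
rewrite -(cvg_lim _ h)//; apply: limr_ge; first by apply/cvg_ex; eexists; exact: h.
by near=> n; rewrite divr_ge0.
Unshelve. all: by end_near. Qed.

Lemma visits_nil x n : visits [::] x n = n.
Proof.
by rewrite /visits (eq_bigr (fun=> 1%N)) ?sum1_card ?card_ord.
Qed.

Lemma freq_nil : freq [::] = 1.
Proof.
have h := freq_cvg [::] admissible_limit_point.
rewrite -(cvg_lim _ h)//; apply: cvg_lim => //.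
rewrite -(cvg_shiftS _ (nbhs (1 : R)))/=.
rewrite (_ : (fun _ => _) = fun=> 1); first exact: cvg_cst.
by apply/funext => n; rewrite visits_nil divff.
Qed.

Lemma eq_visits w w0 w1 x x' n :
  (forall i, (win x i (size w) == w) =
    (win x' i (size w0) == w0) + (win x' i (size w1) == w1) :> nat)%N ->
  visits w x n = (visits w0 x' n + visits w1 x' n)%N.
Proof. by move=> h; rewrite /visits -big_split; apply: eq_bigr => i _; rewrite h. Qed.

Lemma freqD w w0 w1 x x' : admissible x -> admissible x' ->
  (forall i, (win x i (size w) == w) =
    (win x' i (size w0) == w0) + (win x' i (size w1) == w1) :> nat)%N ->
  freq w = freq w0 + freq w1.
Proof.
move=> ax ax' h; have h1 := freq_cvg w ax.
have h2 := cvgD (freq_cvg w0 ax') (freq_cvg w1 ax').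
have E : (fun n => (visits w x n)%:R / n%:R : R) =
    (fun n => (visits w0 x' n)%:R / n%:R) + (fun n => (visits w1 x' n)%:R / n%:R).
  by apply/funext => n; rewrite fctE -mulrDl -natrD -(eq_visits n h).
by rewrite -(cvg_lim _ h1)// E (cvg_lim _ (h2 _)).
Qed.

Lemma bit_eq (a : 'I_2) : ((a == ord0) + (a == ord_max))%N = 1%N.
Proof. by case: a => -[|[|//]] i. Qed.

Lemma freq_rcons w : freq w = freq (rcons w ord0) + freq (rcons w ord_max).
Proof.
apply: (@freqD _ _ _ limit_point limit_point) => [||i];
  try exact: admissible_limit_point.
rewrite !size_rcons -[(size w).+1]addn1 win_cat /= cats1 !eqseq_rcons.
by case: (_ == w) => //=; rewrite bit_eq.
Qed.

(** An occurrence of [w] in the shifted point is, in the point itself, an occurrence of exactly one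
    of its two extensions to the left. This identity will make the measure shift invariant, as
    [freq_rcons] makes it additive. *)
Lemma freq_cons w : freq w = freq (ord0 :: w) + freq (ord_max :: w).
Proof.
apply: (@freqD _ _ _ (fun l => limit_point (l + 1)) limit_point) => [||i];
  try exact: admissible_limit_point.
  by apply: admissible_shift; exact: admissible_limit_point.
rewrite win_shift addn1 /= !eqseq_cons.
by case: (_ == w); rewrite ?andbF// !andbT bit_eq.
Qed.

Lemma freq_forbidden w : (forall x, cylinder w x -> ~ admissible x) -> freq w = 0.
Proof.
move=> h; have := freq_cvg w admissible_limit_point.
rewrite (_ : (fun _ => _) = fun=> 0) => [hc|].
  by rewrite -(cvg_lim _ hc)// lim_cst.
apply/funext => n; rewrite /visits big1 ?mul0r// => i _.
apply/eqP; rewrite eqb0; apply/negP => /eqP E.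
apply: (h (iter i shift_map limit_point)).
  by rewrite /cylinder/= win_iter_shift addn0.
by apply: admissible_iter; exact: admissible_limit_point.
Qed.

End BlockShift.

(** * Unique ergodicity *)

Section InvariantMeasure.
Context {R : realType}.
Local Notation S := (Sigma R 0).
Local Notation Xs := (@block_shift R).
Implicit Types (x y : S) (w : seq 'I_2) (n m k : nat) (mu nu : probability (borel S) R).

Lemma measurable_block_shift : measurable (Xs : set (borel S)).
Proof.
rewrite -[Xs]setCK; apply: measurableC; apply: sub_sigma_algebra.
by apply: closed_openC; have [] := @subshift_block_shift R.
Qed.

Lemma measurable_preimage_iter_shift i (A : set (borel S)) : measurable A ->
  measurable (iter i shift_map @^-1` A : set (borel S)).
Proof.
move=> mA; elim: i => [|i IH]; first by rewrite preimage_id.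
rewrite (_ : _ @^-1` _ = shift_map @^-1` (iter i shift_map @^-1` A)).
  by rewrite -[X in measurable X]setTI; exact: measurable_shift.
by apply/seteqP; split=> x /=; rewrite -iterSr iterS.
Qed.

Lemma invariant_iter nu i (A : set (borel S)) :
  invariant_probability Xs shift_map nu -> measurable A ->
  nu (iter i shift_map @^-1` A) = nu A.
Proof.
move=> [_ inv_nu] mA; elim: i => [|i <-]; first by rewrite preimage_id.
rewrite (_ : _ @^-1` _ = shift_map @^-1` (iter i shift_map @^-1` A)).
  by rewrite inv_nu//; exact: measurable_preimage_iter_shift.
by apply/seteqP; split=> x /=; rewrite -iterSr iterS.
Qed.

Lemma full_measureI nu (A : set (borel S)) : nu Xs = 1%E -> measurable A ->
  nu (A `&` Xs) = nu A.
Proof.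
move=> nuX mA; have mX := measurable_block_shift.
rewrite [RHS](measureDI nu mA mX)//= [X in (X + _)%E](_ : _ = 0%E) ?add0e//.
apply/eqP; rewrite eq_le measure_ge0 andbT.
have <- : nu (~` Xs) = 0%E by rewrite probability_setC// nuX subee.
apply: le_measure => [| |x []//]; rewrite inE; first exact: measurableD.
exact: measurableC.
Qed.

Lemma visits_indic w x n : (visits w x n)%:R =
  \sum_(i < n) \1_(iter i shift_map @^-1` cylinder w) x :> R.
Proof.
rewrite /visits natr_sum; apply: eq_bigr => i _; rewrite indicE; congr (_%:R).
congr nat_of_bool; apply/eqP/idP.
  by move=> h; rewrite inE /cylinder/= win_iter_shift addn0.
by rewrite inE /cylinder/= win_iter_shift addn0.
Qed.

Lemma integral_visits nu w n : invariant_probability Xs shift_map nu ->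
  (\int[nu]_(x in Xs) (visits w x n)%:R%:E = n%:R%:E * nu (cylinder w))%E.
Proof.
move=> inv_nu; have mX := measurable_block_shift.
under eq_integral do rewrite visits_indic -sumEFin.
rewrite ge0_integral_sum//; last first.
  move=> i; apply: measurable_funTS; apply/measurable_EFinP.
  apply: measurable_indic; apply: measurable_preimage_iter_shift.
  exact: measurable_cylinder.
rewrite (eq_bigr (fun=> nu (cylinder w))) => [|i _].
  by rewrite sumr_const card_ord mule_natl.
have mi : measurable (iter i shift_map @^-1` cylinder w : set (borel S)).
  by apply: measurable_preimage_iter_shift; exact: measurable_cylinder.
rewrite integral_indic//; apply: etrans (full_measureI inv_nu.1 mi) _.
by apply: invariant_iter => //; exact: measurable_cylinder.
Qed.

Lemma measurable_visits w n D :
  measurable_fun D (fun x : borel S => (visits w x n)%:R%:E : \bar R).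
Proof.
apply: measurable_funTS; apply/measurable_EFinP.
rewrite (_ : (fun _ => _) = fun x =>
    \sum_(i < n) \1_(iter i shift_map @^-1` cylinder w) x).
  apply: measurable_sum => i; apply: measurable_indic.
  by apply: measurable_preimage_iter_shift; exact: measurable_cylinder.
by apply/funext => x; rewrite visits_indic.
Qed.

Lemma invariant_visits_ge nu w n a : invariant_probability Xs shift_map nu ->
  (0 < n)%N -> (forall x, Xs x -> a <= (visits w x n)%:R / n%:R) ->
  (a%:E <= nu (cylinder w))%E.
Proof.
move=> inv_nu n0 h; have mX := measurable_block_shift.
(* Nonpositive [a] is set aside because [ge0_le_integral] compares nonnegative functions. *)
have [a0|a0] := leP a 0; first by apply: le_trans (measure_ge0 _ _); rewrite lee_fin.
have nR : 0 < n%:R :> R by rewrite ltr0n.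
rewrite -(@lee_pmul2l _ n%:R%:E)// -integral_visits//.
have -> : (n%:R%:E * a%:E = \int[nu]_(x in Xs) (cst (n%:R * a)%:E x))%E.
  by rewrite integral_cst//= inv_nu.1 mule1.
apply: ge0_le_integral => //=.
- by move=> x _; rewrite lee_fin mulr_ge0// ltW.
- exact: measurable_visits.
- by move=> x Xx; rewrite lee_fin -ler_pdivlMl// mulrC; exact: h.
Qed.

Lemma invariant_visits_le nu w n b : invariant_probability Xs shift_map nu ->
  (0 < n)%N -> (forall x, Xs x -> (visits w x n)%:R / n%:R <= b) ->
  (nu (cylinder w) <= b%:E)%E.
Proof.
move=> inv_nu n0 h; have mX := measurable_block_shift.
have nR : 0 < n%:R :> R by rewrite ltr0n.
rewrite -(@lee_pmul2l _ n%:R%:E)// -integral_visits//.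
have -> : (n%:R%:E * b%:E = \int[nu]_(x in Xs) (cst (n%:R * b)%:E x))%E.
  by rewrite integral_cst//= inv_nu.1 mule1.
apply: ge0_le_integral => //=.
- exact: measurable_visits.
- by move=> x Xx; rewrite lee_fin mulrC -ler_pdivrMr//; exact: h.
Qed.

(** The frequencies converge uniformly on the subshift, so integrating them against [nu] forces the
    value. *)
Lemma invariant_cylinder nu w : invariant_probability Xs shift_map nu ->
  nu (cylinder w) = (freq w)%:E.
Proof.
move=> inv_nu; apply/eqP; rewrite eq_le; apply/andP; split.
- apply/lee_addgt0Pr => e e0; have [N hN] := freq_uniform (R := R) w e0.
  rewrite -EFinD; apply: (@invariant_visits_le _ _ N.+1) => // x Xsx.
  have := hN N.+1 x (leqnSn _) Xsx; rewrite ler_norml => /andP[_ h].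
  by rewrite -lerBlDl.
- apply/lee_subgt0Pr => e e0; have [N hN] := freq_uniform (R := R) w e0.
  rewrite -EFinB; apply: (@invariant_visits_ge _ _ N.+1) => // x Xsx.
  have := hN N.+1 x (leqnSn _) Xsx; rewrite ler_norml => /andP[h _].
  by rewrite lerBlDl -lerBlDr; move: h; rewrite lerNl opprB lerBlDl -lerBlDr.
Qed.

Lemma invariant_unique mu nu : invariant_probability Xs shift_map mu ->
  invariant_probability Xs shift_map nu ->
  forall A : set (borel S), measurable A -> nu A = mu A.
Proof.
move=> imu inu; apply: cylinder_measure_unique => w.
by rewrite !invariant_cylinder.
Qed.

End InvariantMeasure.

(** * Existence of an invariant measure *)

Section Existence.
Context {R : realType}.
Local Notation S := (Sigma R 0).
Implicit Types (x y : S) (w u : seq 'I_2) (n m k : nat) (t : R).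
Local Notation freq := (@freq R).

(* The intervals [[low [::] w, low [::] w + freq w[], for [w] of length n, form a
   partition of [[0, 1[] that becomes finer as n grows; [code t n] is the word
   whose interval contains [t], so that the invariant measure is the image of
   the Lebesgue measure under [code_point].  The argument [u] of [low] collects
   the letters already read. *)
Fixpoint low u w : R :=
  if w is a :: w' then
    (if a == ord0 then 0 else freq (rcons u ord0)) + low (rcons u a) w'
  else 0.

Lemma low_rcons u w a : low u (rcons w a) =
  low u w + (if a == ord0 then 0 else freq (rcons (u ++ w) ord0)).
Proof.
elim: w u => [|b w IH] u /=; first by rewrite cats0 addr0 add0r.
by rewrite IH cat_rcons addrA.
Qed.

Fixpoint code t n : seq 'I_2 :=
  if n is n'.+1 then
    rcons (code t n')
      (if low [::] (code t n') + freq (rcons (code t n') ord0) <= t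
       then ord_max else ord0)
  else [::].

Definition code_point t : S := fun i => last ord0 (code t i.+1).

Lemma win_code_point t n : win (code_point t) 0 n = code t n.
Proof.
elim: n => // n IH; rewrite -(addn1 n) win_cat IH addn1 /= cats1 add0n; congr rcons.
by rewrite /code_point /= last_rcons.
Qed.

Lemma ordinal2_cases (a : 'I_2) : a = ord0 \/ a = ord_max.
Proof. by case: a => -[|[|//]] i; [left|right]; apply/val_inj. Qed.

Lemma ord_max_eq0 : (ord_max == ord0 :> 'I_2) = false.
Proof. by []. Qed.

Lemma ord0_eq_max : (ord0 == ord_max :> 'I_2) = false.
Proof. by []. Qed.

Lemma low_bounds w : 0 <= low [::] w /\ low [::] w + freq w <= 1.
Proof.
elim/last_ind: w => [|w a [l0 l1]]; first by rewrite /= add0r freq_nil.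
have h := freq_rcons (R := R) w.
have f0 := freq_ge0 (R := R) (rcons w ord0).
have f1 := freq_ge0 (R := R) (rcons w ord_max).
by rewrite low_rcons cat0s; have [->|->] := ordinal2_cases a => /=; split; lra.
Qed.

(** By [freq_rcons] the interval of [w] splits into those of its two extensions; the threshold
    tested by [code] is the point where they meet, and it belongs to the upper one. *)
Lemma codeP t w : 0 <= t < 1 ->
  (code t (size w) == w) = (low [::] w <= t < low [::] w + freq w).
Proof.
move=> t01; elim/last_ind: w => [|w a IH].
  by rewrite /= add0r freq_nil t01.
rewrite size_rcons /= eqseq_rcons IH low_rcons cat0s.
have h := freq_rcons (R := R) w.
have f0 := freq_ge0 (R := R) (rcons w ord0).
have f1 := freq_ge0 (R := R) (rcons w ord_max).
have [E|nE] := eqVneq (code t (size w)) w.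
  move: IH; rewrite E eqxx => /esym /andP[l1 l2]; rewrite l1 l2 /=.
  have [->|->] := ordinal2_cases a;
    case: (leP (low [::] w + freq (rcons w ord0)) t) => ct;
    rewrite ?eqxx ?ord_max_eq0 ?ord0_eq_max.
  - by apply/esym/negbTE; rewrite addr0 negb_and -leNgt ct orbT.
  - by rewrite addr0 l1 ct.
  - by rewrite -addrA -h l2.
  - by [].
rewrite (negbTE nE) in IH; have /esym/negbT := IH; rewrite negb_and => nl.
rewrite -IH /=; apply/esym/negbTE; rewrite negb_and -ltNge -leNgt.
move: nl; rewrite -ltNge -leNgt.
have [->|->] := ordinal2_cases a => /= /orP[nl|nl]; apply/orP; lra.
Qed.

Lemma measurable_code w : measurable [set t : R | code t (size w) = w].
Proof.
elim/last_ind: w => [|w a IH].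
  by rewrite (_ : [set _ | _] = setT)//; apply/seteqP; split.
pose c := low [::] w + freq (rcons w ord0).
have mc : measurable [set t : R | c <= t].
  by rewrite (_ : [set _ | _] = `[c, +oo[%classic)//; apply/seteqP; split=> t /=;
    rewrite in_itv/= andbT.
rewrite (_ : [set _ | _] = [set t | code t (size w) = w] `&`
    (if a == ord0 then ~` [set t | c <= t] else [set t | c <= t])); last first.
  apply/seteqP; split=> t /=; rewrite size_rcons /=.
    move=> /eqP; rewrite eqseq_rcons => /andP[/eqP E]; rewrite E -/c.
    by have [->|->] := ordinal2_cases a => /=; case: ifP => // /negbT/negP.
  move=> [->]; rewrite -/c; have [->|->] := ordinal2_cases a => /=.
    by move=> /negP/negbTE ->.
  by move=> ->.
by apply: measurableI => //; case: ifP => _ //; exact: measurableC.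
Qed.

Lemma preimage_code_point w :
  code_point @^-1` cylinder w = [set t | code t (size w) = w].
Proof. by apply/seteqP; split=> t /=; rewrite /cylinder/= win_code_point. Qed.

Lemma measurable_code_point :
  measurable_fun setT (code_point : measurableTypeR R -> borel S).
Proof.
apply: measurable_fun_cylinder => w; rewrite preimage_code_point.
exact: measurable_code.
Qed.

Definition invariant_measure : probability (borel S) R :=
  distribution (uniform_prob (@ltr01 R)) (mfun_Sub (mem_set measurable_code_point)).

Lemma invariant_measure_cylinder w : invariant_measure (cylinder w) = (freq w)%:E.
Proof.
rewrite /invariant_measure /distribution /= /pushforward/= preimage_code_point.
set A := [set t | _]; have mA : measurable A := measurable_code w.
rewrite /uniform_prob integral_uniform_pdf (eq_integral (fun=> 1%E)); last first.
  by move=> t; rewrite inE /= in_itv/= /uniform_pdf => -[_ ->]; rewrite subr0 invr1.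
rewrite integral_cst//=; last by apply: measurableI.
rewrite mul1e.
have [l0 l1] := low_bounds w.
(* The uniform law lives on the closed unit interval, while [codeP] excludes the endpoint 1, which
   is therefore split off as a null set. *)
have -> : A `&` `[0, 1]%classic =
    `[low [::] w, low [::] w + freq w[%classic `|` (A `&` [set 1]).
  apply/seteqP; split=> t /=; rewrite !in_itv/=.
    move=> [At /andP[t0]]; rewrite le_eqVlt => /orP[/eqP t1|t1].
      by right; split.
    by left; rewrite -codeP ?t0//; apply/eqP.
  move=> [/andP[lt tl]|[At t1]]; last by rewrite t1 ler01 lexx in At *.
  have t01 : 0 <= t < 1 by rewrite (le_trans l0)//= (lt_le_trans tl).
  split; last by case/andP: t01 => -> /ltW ->.
  by apply/eqP; rewrite codeP// lt tl.
have m1 : measurable (A `&` [set 1]) by exact: measurableI.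
rewrite measureU0//; last first.
  apply/eqP; rewrite eq_le measure_ge0 andbT -(lebesgue_measure_set1 (1 : R)).
  by apply: le_measure; rewrite ?inE//; exact: subIsetr.
apply: etrans (lebesgue_measure_itv `[low [::] w, low [::] w + freq w[) _.
rewrite /= lte_fin ltrDl; case: ltP => [_|f0].
  by rewrite -EFinB addrC addKr.
by apply/eqP; rewrite eq_le !lee_fin f0 freq_ge0.
Qed.

(** The complement is a countable union of cylinders of words with which no admissible point starts,
    and such words have frequency 0; [choice.unpickle] enumerates the words. *)
Lemma invariant_measure_block_shift : invariant_measure (@block_shift R) = 1%E.
Proof.
have mX := @measurable_block_shift R.
pose D w := forall x : S, cylinder w x -> ~ admissible x.
pose F n : set (borel S) :=
  if @choice.unpickle (seq 'I_2) n is Some w then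
    (if `[< D w >] then cylinder w else set0)
  else set0.
have F0 n : invariant_measure.-negligible (F n).
  rewrite /F; case: (choice.unpickle n) => [w|]; last exact: negligible_set0.
  case: asboolP => Dw; last exact: negligible_set0.
  apply/negligibleP; first exact: measurable_cylinder.
  by rewrite [LHS]invariant_measure_cylinder freq_forbidden.
have /measure_negligible h0 : invariant_measure.-negligible (~` @block_shift R).
  apply: negligibleS (negligible_bigcup F0) => x xX.
  have /existsNP[n xn] : ~ admissible x by [].
  exists (choice.pickle (win x 0 n)) => //; rewrite /F choice.pickleK asboolT.
    by rewrite /cylinder/= size_win.
  move=> y; rewrite /cylinder/= size_win => E ay; apply: xn.
  by have := ay n; rewrite E.
rewrite -(setCK (@block_shift R)) probability_setC; last exact: measurableC.
by rewrite h0 ?sube0//; exact: measurableC.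
Qed.

Lemma invariant_measure_invariant :
  invariant_probability (@block_shift R) shift_map invariant_measure.
Proof.
split; first exact: invariant_measure_block_shift.
move=> A mA.
pose nu : probability (borel S) R :=
  distribution invariant_measure (mfun_Sub (mem_set (@measurable_shift R))).
have -> : invariant_measure (shift_map @^-1` A) = nu A by [].
apply: cylinder_measure_unique => // w.
rewrite [LHS](_ : _ = invariant_measure (shift_map @^-1` cylinder w))//.
rewrite preimage_shift_cylinder measureU; last 3 first.
- exact: measurable_cylinder.
- exact: measurable_cylinder.
- apply/seteqP; split => x //=; rewrite /cylinder/= => -[[h0 _] [h1 _]].
  by move: h0; rewrite h1.
rewrite invariant_measure_cylinder freq_cons EFinD.
by congr (_ + _)%E; exact: invariant_measure_cylinder.
Qed.

End Existence.

(** * Correlation and topological entropies *)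

Section LimitBounds.
Context {R : realType}.
Implicit Type u v : (\bar R)^nat.
Local Open Scope ereal_scope.

Lemma limn_einf_ge u a : (\forall n \near \oo, a <= u n) -> a <= limn_einf u.
Proof.
move=> [N _ h]; rewrite limn_einf_lim; apply: lime_ge; first exact: is_cvg_einfs.
exists N => // n /= Nn; apply: le_ereal_inf_tmp => _ [m /= nm <-].
by apply: h => /=; exact: leq_trans nm.
Qed.

Lemma limn_esup_le u a : (\forall n \near \oo, u n <= a) -> limn_esup u <= a.
Proof.
move=> [N _ h]; rewrite limn_esup_lim; apply: lime_le; first exact: is_cvg_esups.
exists N => // n /= Nn; apply: ge_ereal_sup => _ [m /= nm <-].
by apply: h => /=; exact: leq_trans nm.
Qed.

Lemma limn_esup_ge_often u a : (forall N, exists2 n, (N <= n)%N & a <= u n) ->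
  a <= limn_esup u.
Proof.
move=> h; rewrite limn_esup_lim; apply: lime_ge; first exact: is_cvg_esups.
near=> N; have [n Nn an] := h N; apply: le_trans an _.
by apply: ereal_sup_ubound; exists n.
Unshelve. all: by end_near. Qed.

Lemma limn_esup_le_mono u v : (forall n, u n <= v n) -> limn_esup u <= limn_esup v.
Proof.
move=> uv; rewrite !limn_esup_lim; apply: lee_lim; try exact: is_cvg_esups.
near=> N; apply: ge_ereal_sup => _ [m /= Nm <-]; apply: le_trans (uv m) _.
by apply: ereal_sup_ubound; exists m.
Unshelve. all: by end_near. Qed.

Lemma at_right_eq0 (f : R -> \bar R) : (forall e, (0 < e)%R -> f e = 0) ->
  f e @[e --> 0%R^'+] --> 0.
Proof.
move=> f0; have E : {near (0%R : R)^'+, cst 0 =1 f}.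
  by near=> e; rewrite f0//; near: e; exact: nbhs_right_gt.
exact: cvg_trans (near_eq_cvg E) (cvg_cst _).
Unshelve. all: by end_near. Qed.

End LimitBounds.

Section PolynomialDecay.
Context {R : realType}.

Lemma ln_poly_small (k : nat) (e : R) : 0 < e ->
  \forall m \near \oo, ln ((5 * (m + k).+1)%:R ^+ 8) <= e * m%:R :> R.
Proof.
move=> e0; pose M := (Num.bound (2560 / e ^+ 2) + k).+1.
exists M => // m /= Mm.
have mk : (m + k).+1%:R <= 2 * m%:R :> R.
  by rewrite -natrM ler_nat; move: Mm; rewrite /M; lia.
have m0 : 0 < m%:R :> R by rewrite ltr0n; exact: leq_trans Mm.
have em : 2560 <= e ^+ 2 * m%:R.
  rewrite mulrC -ler_pdivrMr ?exprn_gt0//.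
  have /archi_boundP/ltW/le_trans : 0 <= 2560 / e ^+ 2.
    by apply: divr_ge0; [exact: ler0n|exact/exprn_ge0/ltW].
  by apply; rewrite ler_nat (leq_trans _ Mm)// /M ltnW// ltnS leq_addr.
have z0 : 0 < e * m%:R / 16 by rewrite divr_gt0// mulr_gt0.
have y0 : 0 < 5 * (m + k).+1%:R :> R by rewrite mulr_gt0.
have small : 5 * (m + k).+1%:R <= (e * m%:R / 16) ^+ 2.
  apply: (@le_trans _ _ (10 * m%:R)); first by lra.
  rewrite (_ : (e * m%:R / 16) ^+ 2 = e ^+ 2 * m%:R / 256 * m%:R); last by field.
  by rewrite ler_pM2r//; lra.
have h : ln (5 * (m + k).+1%:R : R) <= e * m%:R / 8.
  apply: (@le_trans _ _ (ln ((e * m%:R / 16) ^+ 2))).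
    by rewrite ler_ln ?posrE// exprn_gt0.
  rewrite lnXn// mulr2n; have := ln_sublinear z0; lra.
by rewrite natrM lnXn// -[_ *+ 8]mulr_natl; lra.
Qed.


(** The bounds make - log (C m) at most of order log m. In the applications [k] is the number of
    extra letters that the precision 2^-k demands, and 8 is twice 4 because frequencies get
    squared. *)
Lemma decay_rate_poly (C : nat -> \bar R) k :
  (forall m, (((5 * (m + k).+1)%:R ^- 8)%:E <= C m <= 1)%E) ->
  limn_einf (fun m => decay_rate m (C m)) = 0%E /\
  limn_esup (fun m => decay_rate m (C m)) = 0%E.
Proof.
move=> hC.
pose a m : R := (5 * (m + k).+1)%:R ^+ 8.
have a0 m : 0 < a m by rewrite exprn_gt0// ltr0n.
have [c cE] : exists c : nat -> R, forall m, C m = (c m)%:E /\ (a m)^-1 <= c m <= 1.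
  exists (fine \o C) => m; have /andP[h1 h2] := hC m => /=.
  have fC : C m \is a fin_num.
    by rewrite fin_numElt (lt_le_trans (ltNyr _) h1) (le_lt_trans h2 (ltry _)).
  by split; [rewrite fineK|rewrite -!lee_fin fineK// h1 h2].
suff h : decay_rate m (C m) @[m --> \oo] --> 0%E by have [-> ->] := cvg_limn_einf_sup h.
have E m : decay_rate m (C m) = (- ln (c m) / m%:R)%:E.
  have [-> /andP[h1 h2]] := cE m.
  rewrite /decay_rate lne_EFin; last by apply: lt_le_trans h1; rewrite invr_gt0.
  by rewrite -EFinN -EFinM mulNr mulrC mulNr.
under eq_fun do rewrite E.
apply: cvg_EFin; first by near=> m.
apply/cvgrPdist_le => e e0; have := ln_poly_small k e0; rewrite -/a => h.
near=> m; rewrite /= sub0r normrN.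
have [_ /andP[h1 h2]] := cE m.
have m0 : 0 < m%:R :> R by rewrite ltr0n; near: m; exact: nbhs_infty_gt.
have c0 : 0 < c m by apply: lt_le_trans h1; rewrite invr_gt0.
rewrite ger0_norm; last by rewrite divr_ge0// oppr_ge0 ln_le0.
rewrite ler_pdivrMr//; apply: (@le_trans _ _ (ln (a m))).
  rewrite lerNl -lnV ?posrE// ler_ln ?posrE ?invr_gt0//.
by near: m.
Unshelve. all: by end_near. Qed.

End PolynomialDecay.

(** The count in each word of stage [k] carries over to long windows with a loss of a factor 2: n <=
    (q + 2) [len k] <= 2 q [len k] as soon as q >= 2, which n >= 4 [len k] ensures. The 5 comes from
    2 * 288 <= 5^4. *)
Lemma visits_frequent m : exists w, size w = m /\ exists N, forall n x,
  (N <= n)%N -> admissible x -> (n <= (5 * m.+1) ^ 4 * visits w x n)%N.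
Proof.
have [w [k [wm l0 h]]] := frequent_word m.
exists w; split => //; exists (4 * len k)%N => n x Nn ax.
set D := (288 * m.+1 ^ 4)%N in h.
have D0 : (0 < D)%N by rewrite muln_gt0 expn_gt0.
(* The quotient of [len k] by [D] rounded up: still a lower bound for the integer [occ w v], and
   [g * D] does not fall below [len k]. *)
pose g := ((len k).-1 %/ D).+1.
have gD : (len k <= g * D)%N.
  by rewrite -(prednK l0); exact: ltn_ceil.
have gk : {in blocks k, forall v, (g <= occ w v <= len k)%N}.
  move=> v vk; have ov := occ_size w v; rewrite (size_block vk) in ov.
  rewrite ov andbT /g ltn_divLR//.
  have := h v vk; rewrite mulnC; move: (occ w v) => o; lia.
have [q [q1 q2 q3 _]] := visits_bounds n ax gk.
have D5 : (2 * D <= (5 * m.+1) ^ 4)%N by rewrite expnMn /D mulnA leq_mul2r orbT.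
apply: (@leq_trans (2 * D * visits w x n)); last by rewrite leq_mul2r D5 orbT.
move: (visits w x n) q3 => v q3.
have q4 : (2 <= q)%N.
  by rewrite -(leq_add2r 2) -(leq_pmul2r l0); exact: leq_trans Nn q2.
apply: leq_trans q2 _; apply: (@leq_trans (2 * (q * (g * D))))%N.
  by apply: (@leq_trans (2 * q * len k))%N; [rewrite leq_mul2r; lia|
    rewrite -mulnA !leq_mul].
rewrite (_ : 2 * (q * (g * D)) = 2 * D * (q * g))%N ?leq_mul//; lia.
Qed.

Section Entropies.
Context {R : realType}.
Local Notation S := (Sigma R 0).
Local Notation Xs := (@block_shift R).
Implicit Types (x y z : S) (w : seq 'I_2) (n m k : nat) (mu : probability (borel S) R).

Lemma visits_frequentR m : exists w, size w = m /\ exists N, forall n x,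
  (N <= n)%N -> (0 < n)%N -> admissible x ->
  (5 * m.+1)%:R ^- 4 <= (visits w x n)%:R / n%:R :> R.
Proof.
have [w [wm [N h]]] := visits_frequent m; exists w; split => //.
exists N => n x Nn n0 ax; have := h n x Nn ax.
rewrite -(ler_nat R) natrM natrX => {}h.
rewrite ler_pdivlMr ?ltr0n// ler_pdivrMl ?exprn_gt0 ?ltr0n//.
Qed.

Lemma bowen_leP m y z eps : 0 <= eps ->
  bowen_dist shift_map m y z <= eps <->
  forall i j, (i < m)%N -> eps < 2 ^- j -> y (i + j)%N = z (i + j)%N.
Proof.
move=> e0; split=> [/bigmax_leP[_ h] i j im ej|h].
  have /(rho_leP _ _ e0)/(_ j ej) := h (Ordinal im) isT.
  by rewrite !iter_shiftE /= addnC.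
apply/bigmax_leP; split => // i _; apply/(rho_leP _ _ e0) => j ej.
by rewrite !iter_shiftE addnC; exact: h.
Qed.

Lemma eq_win_bowen m k y z eps : 2 ^- k <= eps ->
  win y 0 (m + k) = win z 0 (m + k) -> bowen_dist shift_map m y z <= eps.
Proof.
move=> ke /eq_winP E; apply/bowen_leP => [|i j im ej].
  by apply: le_trans ke; rewrite invr_ge0 exprn_ge0.
apply: E; have := le_lt_trans ke ej.
rewrite ltf_pV2 ?posrE ?exprn_gt0// ltr_eXn2l ?ltr1n//; lia.
Qed.

Lemma correlation_sum_le1 m x n eps : correlation_sum shift_map m x n eps <= 1 :> R.
Proof.
rewrite /correlation_sum; case: n => [|n].
  by rewrite expr0n invr0 mulr0.
rewrite ler_pdivrMr ?exprn_gt0 ?ltr0n// mul1r -natrX ler_nat.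
by apply: leq_trans (max_card _) _; rewrite card_prod card_ord mulnn.
Qed.

(** Two visits to the same word of length m + k stay within 2^-k of each other for m steps, so every
    pair of visits is counted. *)
Lemma correlation_sum_ge m k w x n eps : 2 ^- k <= eps -> size w = (m + k)%N ->
  ((visits w x n)%:R / n%:R) ^+ 2 <= correlation_sum shift_map m x n eps :> R.
Proof.
move=> ke wm; rewrite /correlation_sum expr_div_n ler_wpM2r ?invr_ge0 ?exprn_ge0//.
rewrite -natrX ler_nat.
pose A := [pred i : 'I_n | win x i (size w) == w].
have -> : visits w x n = #|A| by rewrite /visits -sum1_card [RHS]big_mkcond.
rewrite -mulnn -cardX; apply: subset_leq_card; apply/fintype.subsetP => -[i j].
rewrite !inE /= => /andP[/eqP iw /eqP jw]; apply: eq_win_bowen ke _.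
by rewrite !win_iter_shift !addn0 -wm iw jw.
Qed.

(** For each fixed [eps] both correlations lie between the squared frequency bound and 1, so the
    rates vanish already before [eps] tends to 0. *)
Lemma local_correlation_block_shift x : admissible x ->
  local_correlation_entropy_is shift_map x 0%E.
Proof.
move=> ax.
have bound eps m k : 2 ^- k <= eps ->
    (((5 * (m + k).+1)%:R ^- 8)%:E <= lower_correlation shift_map m x eps)%E.
  move=> ke; have [w [wm [N h]]] := visits_frequentR (m + k).
  apply: limn_einf_ge; near=> n; rewrite lee_fin.
  apply: le_trans (correlation_sum_ge x n ke wm).
  rewrite (_ : _ ^- 8 = ((5 * (m + k).+1)%:R ^- 4) ^+ 2); last first.
    by rewrite exprVn -exprM.
  rewrite lerXn2r ?nnegrE ?invr_ge0 ?divr_ge0//.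
  by apply: h => //; near: n; [exact: nbhs_infty_ge|exact: nbhs_infty_gt].
have up eps m : (upper_correlation shift_map m x eps <= 1)%E.
  by apply: limn_esup_le; near=> n; rewrite lee_fin correlation_sum_le1.
have lu eps m : (lower_correlation shift_map m x eps <=
    upper_correlation shift_map m x eps)%E by exact: limn_einf_sup.
split; apply: at_right_eq0 => e e0; have [k /ltW ke] := exp2V_lt e0.
- have [] // := @decay_rate_poly R (fun m => lower_correlation shift_map m x e) k.
  by move=> m; rewrite bound// (le_trans (lu _ _)).
- have [] // := @decay_rate_poly R (fun m => upper_correlation shift_map m x e) k.
  by move=> m; rewrite up andbT (le_trans (bound _ _ _ ke)).
Unshelve. all: by end_near. Qed.

Lemma measurable_coordinate i a : measurable ([set y | y i = a] : set (borel S)).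
Proof.
rewrite (_ : [set _ | _] = iter i shift_map @^-1` cylinder [:: a]).
  by apply: measurable_preimage_iter_shift; exact: measurable_cylinder.
apply/seteqP; split=> y /=; rewrite /cylinder/= win_iter_shift addn0 /win /=.
  by move=> ->.
by case.
Qed.

Lemma measurable_coordinate_eq i :
  measurable ([set yz | yz.1 i = yz.2 i] : set (borel S * borel S)).
Proof.
rewrite (_ : [set _ | _] =
    ([set y : borel S | y i = ord0] `*` [set z : borel S | z i = ord0]) `|`
    ([set y : borel S | y i = ord_max] `*` [set z : borel S | z i = ord_max])).
  by apply: measurableU; apply: measurableX; exact: measurable_coordinate.
apply/seteqP; split=> [[y z] /= E|[y z] /= [[-> ->]|[-> ->]]//].
by rewrite -E; have [->|->] := ordinal2_cases (y i); [left|right].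
Qed.

Lemma measurable_bowen m eps : 0 <= eps ->
  measurable ([set yz | bowen_dist shift_map m yz.1 yz.2 <= eps] :
    set (borel S * borel S)).
Proof.
move=> e0.
rewrite (_ : [set _ | _] = \bigcap_l (if `[< exists i j,
    [/\ (i < m)%N, eps < 2 ^- j & l = (i + j)%N] >]
  then [set yz | yz.1 l = yz.2 l] else setT)).
  apply: bigcapT_measurable => l; case: ifP => _ //.
  exact: measurable_coordinate_eq.
apply/seteqP; split=> -[y z] /=.
  move=> /(bowen_leP _ _ _ e0) h l _; case: asboolP => // -[i [j [im ej ->]]].
  exact: h.
move=> h; apply/bowen_leP => // i j im ej.
by have := h (i + j)%N I; rewrite asboolT; [|exists i, j].
Qed.

(** The same squeeze, with the square of a frequent cylinder in place of the pairs of visits. *)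
Lemma correlation_block_shift mu : invariant_probability Xs shift_map mu ->
  correlation_entropy_is Xs shift_map mu 0%E.
Proof.
move=> imu; have mX := @measurable_block_shift R.
have mE m eps : 0 <= eps -> measurable ([set yz | [/\ Xs yz.1, Xs yz.2 &
    bowen_dist shift_map m yz.1 yz.2 <= eps]] : set (borel S * borel S)).
  move=> e0; rewrite (_ : [set _ | _] = (Xs `*` Xs) `&`
      [set yz | bowen_dist shift_map m yz.1 yz.2 <= eps]).
    by apply: measurableI; [exact: measurableX|exact: measurable_bowen].
  by apply/seteqP; split=> [yz [? ? ?]|yz [[? ?] ?]].
have up eps m : 0 <= eps -> (measure_correlation Xs shift_map mu m eps <= 1)%E.
  move=> e0; have E : (mu \x mu)%E setT = 1%E.
    rewrite -setXTT product_measure1E// -[RHS]mule1.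
    by congr (_ * _)%E; exact: probability_setT.
  rewrite -E; apply: le_measure; rewrite ?inE//; exact: mE.
have lo eps m k : 0 <= eps -> 2 ^- k <= eps ->
    (((5 * (m + k).+1)%:R ^- 8)%:E <= measure_correlation Xs shift_map mu m eps)%E.
  move=> e0 ke; have [w [wm [N h]]] := visits_frequentR (m + k).
  have mw : (((5 * (m + k).+1)%:R ^- 4)%:E <= mu (cylinder w))%E.
    by apply: (@invariant_visits_ge _ _ _ N.+1) => // x Xx; apply: h.
  have mC := measurable_cylinder w (R := R).
  apply: (@le_trans _ _ ((mu \x mu)%E ((cylinder w `&` Xs) `*` (cylinder w `&` Xs)))).
    rewrite product_measure1E//; try exact: measurableI.
    rewrite (_ : _ ^- 8 = (5 * (m + k).+1)%:R ^- 4 * (5 * (m + k).+1)%:R ^- 4).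
      rewrite EFinM; apply: lee_pmul; rewrite ?lee_fin ?invr_ge0 ?exprn_ge0//.
        by apply: le_trans mw _; rewrite -(full_measureI imu.1 mC).
      by apply: le_trans mw _; rewrite -(full_measureI imu.1 mC).
    by rewrite -expr2 exprVn -exprM.
  apply: le_measure; rewrite ?inE; [|exact: mE|].
    by apply: measurableX; exact: measurableI.
  move=> [y z] [[/= yw Xy] [zw Xz]]; split => //.
  by apply: eq_win_bowen ke _; rewrite -wm yw zw.
split; apply: at_right_eq0 => e e0; have [k /ltW ke] := exp2V_lt e0.
- have [] // := @decay_rate_poly R (fun m => measure_correlation Xs shift_map mu m e) k.
  by move=> m; rewrite lo ?up// ltW.
- have [] // := @decay_rate_poly R (fun m => measure_correlation Xs shift_map mu m e) k.
  by move=> m; rewrite lo ?up// ltW.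
Qed.

(** One point of the subshift is chosen for each word of stage [k]. As [eps] is below 1 = 2^-0, two
    points that differ at some i < [len k] are separated at time i. *)
Lemma separation_number_ge k eps : 0 < eps < 1 ->
  ((num k)%:R%:E <= separation_number Xs shift_map (len k) eps)%E.
Proof.
move=> /andP[e0 e1].
have /choice[f fP] : forall v, exists x : S, v \in blocks k ->
    admissible x /\ win x 0 (len k) = v.
  move=> v.
  have [vk|] := boolP (v \in blocks k); last by exists limit_point.
  have [i E] := block_seen vk; exists (iter i shift_map limit_point) => _.
  split; first by apply: admissible_iter; exact: admissible_limit_point.
  by rewrite win_iter_shift addn0.
apply: ereal_sup_ubound; exists [fset y in [seq f v | v <- blocks k]]%fset.
  split=> [y|y z] /=.
    by rewrite inE /= => /mapP[v vk ->]; have [] := fP v vk.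
  rewrite !inE /= => /mapP[v vk ->] /mapP[v' v'k ->].
  have [_ v1] := fP v vk; have [_ v2] := fP v' v'k.
  apply: contraNT; rewrite -leNgt => /(bowen_leP _ _ _ (ltW e0)) h.
  apply/eqP; congr f; rewrite -v1 -v2; apply/eq_winP => i il.
  by rewrite -(addn0 i); apply: h => //; rewrite expr0 invr1.
rewrite card_fseq undup_id ?size_map// map_inj_in_uniq.
  exact: inv_uniq (blocks_invP k).
move=> v v' vk v'k E; have [_ <-] := fP v vk; have [_ <-] := fP v' v'k.
by rewrite E.
Qed.

Lemma separation_number_nonincreasing m eps eps' : eps <= eps' ->
  (separation_number Xs shift_map m eps' <= separation_number Xs shift_map m eps)%E.
Proof.
move=> ee; apply: ereal_sup_le => _ [E [EX sE] <-]; exists E => //; split => //.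
by move=> y z yE zE yz; apply: le_lt_trans ee _; exact: sE.
Qed.

Lemma separation_number_ge0 m eps : (0 <= separation_number Xs shift_map m eps)%E.
Proof.
apply: ereal_sup_ubound; exists fset0; last by rewrite cardfs0.
by split=> [y|y z] /=; rewrite ?inE.
Qed.

Lemma topological_entropy_block_shift :
  exists2 h : \bar R, topological_entropy_is Xs shift_map h & (0 < h)%E.
Proof.
pose g eps : \bar R := limn_esup (fun m =>
  (m%:R^-1)%:E * lne (separation_number Xs shift_map m eps))%E.
have gmono : {in Interval (BRight 0) (BLeft 1) &, nonincreasing_fun g}.
  move=> e e' _ _ ee; apply: limn_esup_le_mono => n.
  apply: lee_wpmul2l; first by rewrite lee_fin invr_ge0.
  rewrite lee_lne ?in_itv/= ?separation_number_ge0 ?leey//.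
  exact: separation_number_nonincreasing.
have gh : g e @[e --> 0^'+] --> ereal_sup (g @` [set` Interval (BRight 0) (BLeft 1)]).
  by apply: nonincreasing_at_right_cvge gmono; rewrite ltBSide /= ltr01.
eexists; first exact: gh.
(* By [inv_num], ln ([num N]) / [len N] is at least ln 2 / 2 for every [N], so the times [len N]
   bound the limit superior at [eps] = 1/2 from below. *)
apply: (@lt_le_trans _ _ (ln 2 / 2)%:E).
  by rewrite lte_fin divr_gt0// ln_gt0// ltr1n.
apply: (@le_trans _ _ (g (2^-1))); last first.
  apply: ereal_sup_ubound; exists 2^-1 => //=.
  by rewrite in_itv/= invr_gt0 ltr0n invf_lt1 ?ltr1n.
apply: limn_esup_ge_often => N.
exists (len N); first by rewrite ltnW// inv_len//; exact: blocks_invP.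
have l0 : 0 < (len N)%:R :> R by rewrite ltr0n len_gt0.
have n0 : 0 < (num N)%:R :> R by rewrite ltr0n num_gt0.
apply: (@le_trans _ _ (((len N)%:R^-1)%:E * lne ((num N)%:R : R)%R%:E)%E); last first.
  apply: lee_wpmul2l; first by rewrite lee_fin invr_ge0.
  rewrite lee_lne ?in_itv/= ?separation_number_ge0 ?leey ?lee_fin ?ler0n//.
  by apply: separation_number_ge; rewrite invr_gt0 ltr0n invf_lt1 ?ltr1n.
rewrite lne_EFin// -EFinM lee_fin ler_pdivlMl//.
have := inv_num (blocks_invP N); rewrite -(ler_nat R) !natrX => h.
have : ln ((2 : R) ^+ (len N + 6)) <= ln ((num N)%:R ^+ 2).
  by rewrite ler_ln ?posrE ?exprn_gt0.
rewrite !lnXn// -[ln 2 *+ _]mulr_natl -[ln _ *+ 2]mulr_natl natrD.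
have : 0 <= ln (2 : R) by rewrite ln_ge0// ler1n.
by nra.
Qed.

End Entropies.

Theorem theoremC (R : realType) :
  exists (q : nat) (X : set (Sigma R q)),
    [/\ subshift X,
        strictly_ergodic X shift_map,
        exists2 h : \bar R, topological_entropy_is X shift_map h & (0 < h)%E,
        forall y : Sigma R q, X y -> local_correlation_entropy_is shift_map y 0%E
      & forall mu : probability (borel (Sigma R q)) R,
          invariant_probability X shift_map mu ->
          correlation_entropy_is X shift_map mu 0%E].
Proof.
exists 0%N, (@block_shift R); split.
- exact: subshift_block_shift.
- split; first exact: minimal_block_shift.
  exists (@invariant_measure R); first exact: invariant_measure_invariant.
  by move=> nu inu; apply: invariant_unique inu; exact: invariant_measure_invariant.
- exact: topological_entropy_block_shift.
- exact: local_correlation_block_shift.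
- exact: correlation_block_shift.
Qed.
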